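(* A shift space $X$ is a minimal dendric shift over $\mathcal{A}_3=\{1,2,3\}$ if and only if there exist a permutation $\pi_0\in\Sigma_3$, a sequence $(\sigma_n)_{n\ge1}$ of morphisms in $\Sigma_3\mathcal{S}_3\Sigma_3$ and a sequence $(v_n)_{n\ge1}$ of vertices of the graph $\mathcal{G}'$ described below such that for every $n$, $\sigma_n$ labels an edge of $\mathcal{G}'$ from $v_n$ to $v_{n+1}$, and the directive sequence $(\pi_0,\sigma_1,\sigma_2,\dots)$ is primitive and is an $\mathcal{S}$-adic representation of $X$.
   Context: A shift space over a finite alphabet $\mathcal{A}$ is a closed shift-invariant $X\subseteq\mathcal{A}^{\mathbb{Z}}$ in which every letter occurs; $\mathcal{L}(X)$ is its set of finite factors (including the empty word). $X$ is minimal if its only closed shift-invariant subsets are $\emptyset$ and $X$. For $w\in\mathcal{L}(X)$, the extension graph $\mathcal{E}_X(w)$ is the bipartite graph with left vertices $\{a: aw\in\mathcal{L}(X)\}$, right vertices $\{b: wb\in\mathcal{L}(X)\}$ and an edge $\{a,b\}$ whenever $awb\in\mathcal{L}(X)$; $X$ is dendric if all $\mathcal{E}_X(w)$, $w\in\mathcal{L}(X)$, are trees. Morphisms are non-erasing monoid morphisms. A directive sequence $\boldsymbol\sigma=(\sigma_n:\mathcal{A}_{n+1}^*\to\mathcal{A}_n^* )_{n\ge1}$ is primitive if for every $n$ there is $N>n$ such that every letter of $\mathcal{A}_n$ occurs in $\sigma_n\cdots\sigma_{N-1}(b)$ for all $b\in\mathcal{A}_N$; then it generates the shift $X_{\boldsymbol\sigma}$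 of all $x\in\mathcal{A}_1^{\mathbb{Z}}$ all of whose factors occur in some $\sigma_1\cdots\sigma_{N-1}(a)$, and is called a representation of $X_{\boldsymbol\sigma}$. $\pi_{abc}$ ($\{a,b,c\}=\{1,2,3\}$) is the morphism $1\mapsto a,2\mapsto b,3\mapsto c$; $\Sigma_3$ is the set of these; juxtaposition is composition; by convention $\pi(0)=0$ for $\pi\in\Sigma_3$. $\mathcal{S}_3=\{\alpha,\beta,\gamma,\eta\}\cup\{\delta^{(k)},\zeta^{(k)}:k\ge1\}$ with $\alpha:1\mapsto1,2\mapsto12,3\mapsto13$; $\beta:1\mapsto1,2\mapsto12,3\mapsto132$; $\gamma:1\mapsto1,2\mapsto12,3\mapsto123$; $\delta^{(k)}:1\mapsto1,2\mapsto123^k,3\mapsto123^{k+1}$; $\zeta^{(k)}:1\mapsto13^k,2\mapsto12,3\mapsto13^{k+1}$; $\eta:1\mapsto13,2\mapsto12,3\mapsto123$. $\Sigma_3\mathcal{S}_3\Sigma_3=\{\pi\sigma\pi'\}$. For $l,r\in\{0,1,2,3\}$, define a partial ''image'' map for each $\sigma'\in\mathcal{S}_3$ on pairs $[l,r]$: $\alpha$: $[l,r]\mapsto[l,r]$ (always defined); $\beta$: $[l,r]\mapsto[1,r]$ if $l\ne1$; $\gamma$: $[l,r]\mapsto[l,1]$ if $r\ne1$; $\delta^{(k)}$: $[l,r]\mapsto[3,1]$ if $l\ne1$ and $r\ne1$; $\zeta^{(k)}$: $[l,r]\mapsto[3,3]$ if $l\ne2$ and $r\ne2$; $\eta$: $[l,r]\mapsto[2,3]$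 if $l\ne2$ and $r\ne1$ (undefined otherwise). The graph $\mathcal{G}'$ has vertex set $\{[0,0],[0,3],[3,0],[3,2],[3,3]\}$ (and for each vertex an entering edge labeled by each permutation, corresponding to $\pi_0$); for $\pi,\pi'\in\Sigma_3$ and $\sigma'\in\mathcal{S}_3$ there is an edge from $[l,r]$ to $[l',r']$ labeled $\pi\sigma'\pi'$ if the image of $[\pi'(l'),\pi'(r')]$ under $\sigma'$ is defined and equals $[\pi^{-1}(l),\pi^{-1}(r)]$. *)

(* Defs.v *)
(* Alphabet A_3 = {1,2,3} is encoded as 'I_3 with the
   paper's letter k represented by the ordinal k-1. *)
From mathcomp Require Import all_boot all_order all_algebra all_fingroup.
Set Implicit Arguments. Unset Strict Implicit. Unset Printing Implicit Defensive.
Import GRing.Theory Num.Theory.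
Local Open Scope ring_scope.

Definition letter := 'I_3.
Definition l1 : letter := @Ordinal 3 0 isT.
Definition l2 : letter := @Ordinal 3 1 isT.
Definition l3 : letter := @Ordinal 3 2 isT.

Definition config := int -> letter.

Definition window (x : config) (i : int) (n : nat) : seq letter :=
  [seq x (i + (k%:Z)) | k <- iota 0 n].

Definition lang (X : config -> Prop) (w : seq letter) : Prop :=
  exists x i, X x /\ w = window x i (size w).

Definition shiftmap (x : config) : config := fun i => x (i + 1).

(* closed in the product topology (discrete alphabet): any x all of whose
   cylinders [x_i .. x_(i+n-1)] meet X belongs to X *)
Definition closed_set (X : config -> Prop) : Prop :=
  forall x : config,
    (forall (i : int) (n : nat), exists y, X y /\ window y i n = window x i n) ->
    X x.

Definition shift_invariant (X : config -> Prop) : Prop :=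
  forall x : config, X x <-> X (shiftmap x).

Definition shift_space (X : config -> Prop) : Prop :=
  [/\ closed_set X, shift_invariant X & forall a : letter, lang X [:: a]].

Definition minimal (X : config -> Prop) : Prop :=
  forall Y : config -> Prop, (forall x, Y x -> X x) -> closed_set Y ->
    shift_invariant Y -> (forall x, ~ Y x) \/ (forall x, Y x <-> X x).

Definition evert := (letter + letter)%type.

Fixpoint ppath (T : Type) (e : T -> T -> Prop) (x : T) (p : seq T) : Prop :=
  match p with [::] => True | y :: p' => e x y /\ ppath e y p' end.

Definition ext_vertex (X : config -> Prop) (w : seq letter) (u : evert) : Prop :=
  match u with inl a => lang X (a :: w) | inr b => lang X (rcons w b) end.

Definition ext_edge (X : config -> Prop) (w : seq letter) (u v : evert) : Prop :=
  match u, v with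
  | inl a, inr b => lang X (a :: rcons w b)
  | inr b, inl a => lang X (a :: rcons w b)
  | _, _ => False
  end.

Definition is_tree (T : eqType) (V : T -> Prop) (E : T -> T -> Prop) : Prop :=
  [/\ exists u, V u,
      (forall u v, V u -> V v -> exists p, ppath E u p /\ last u p = v)
    & ~ (exists c : seq T, [/\ (3 <= size c)%N, uniq c, (forall y, y \in c -> V y) &
           match c with [::] => False | x :: p => ppath E x (rcons p x) end])].

Definition extension_graph_is_tree (X : config -> Prop) (w : seq letter) : Prop :=
  @is_tree evert (ext_vertex X w) (ext_edge X w).

Definition dendric (X : config -> Prop) : Prop :=
  forall w, lang X w -> extension_graph_is_tree X w.

(* a non-erasing morphism A_3^* -> A_3^* is determined by the images of letters *)
Definition morph := letter -> seq letter.

Definition apply_morph (f : morph) (w : seq letter) : seq letter :=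
  flatten (map f w).


Definition perm_morph (p : {perm letter}) : morph := fun a => [:: p a].

Inductive S3 := Salpha | Sbeta | Sgamma | Sdelta of nat | Szeta of nat | Seta.

Definition valid_S3 (s : S3) : Prop :=
  match s with Sdelta k | Szeta k => (1 <= k)%N | _ => True end.

Definition on3 (u1 u2 u3 : seq letter) : morph :=
  fun a => if a == l1 then u1 else if a == l2 then u2 else u3.

Definition S3_morph (s : S3) : morph :=
  match s with
  | Salpha => on3 [:: l1] [:: l1; l2] [:: l1; l3]
  | Sbeta => on3 [:: l1] [:: l1; l2] [:: l1; l3; l2]
  | Sgamma => on3 [:: l1] [:: l1; l2] [:: l1; l2; l3]
  | Sdelta k => on3 [:: l1] ([:: l1; l2] ++ nseq k l3) ([:: l1; l2] ++ nseq k.+1 l3)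
  | Szeta k => on3 (l1 :: nseq k l3) [:: l1; l2] (l1 :: nseq k.+1 l3)
  | Seta => on3 [:: l1; l3] [:: l1; l2] [:: l1; l2; l3]
  end.

Definition comp3 (p : {perm letter}) (s : S3) (p' : {perm letter}) : morph :=
  fun a => map p (S3_morph s (p' a)).

(* the value 0 of the paper is None, letter k is Some (letter k) *)
Definition vtx := (option letter * option letter)%type.

Definition G'_vertex (v : vtx) : bool :=
  v \in [:: (None, None); (None, Some l3); (Some l3, None);
           (Some l3, Some l2); (Some l3, Some l3)].

Definition img (s : S3) (v : vtx) : option vtx :=
  let (l, r) := v in
  match s with
  | Salpha => Some (l, r)
  | Sbeta => if l != Some l1 then Some (Some l1, r) else None
  | Sgamma => if r != Some l1 then Some (l, Some l1) else None
  | Sdelta _ => if (l != Some l1) && (r != Some l1) then Some (Some l3, Some l1) else None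
  | Szeta _ => if (l != Some l2) && (r != Some l2) then Some (Some l3, Some l3) else None
  | Seta => if (l != Some l2) && (r != Some l1) then Some (Some l2, Some l3) else None
  end.

Definition pact (p : {perm letter}) (v : vtx) : vtx := (omap p v.1, omap p v.2).

Definition G'_edge (v : vtx) (p : {perm letter}) (s : S3) (p' : {perm letter})
    (v' : vtx) : Prop :=
  [/\ G'_vertex v, G'_vertex v', valid_S3 s &
      img s (pact p' v') = Some (pact p^-1 v)].

Definition labels_edge (f : morph) (v v' : vtx) : Prop :=
  exists (p : {perm letter}) (s : S3) (p' : {perm letter}),
    (forall a, f a = comp3 p s p' a) /\ G'_edge v p s p' v'.

(** * Directive sequences (indexed from 0: tau 0 is the paper's sigma_1) *)
Fixpoint tprod (tau : nat -> morph) (m k : nat) (w : seq letter) : seq letter :=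
  match k with
  | 0 => w
  | k'.+1 => apply_morph (tau m) (tprod tau m.+1 k' w)
  end.

Definition primitive (tau : nat -> morph) : Prop :=
  forall n : nat, exists N : nat, (n < N)%N /\
    forall a b : letter, a \in tprod tau n (N - n) [:: b].

Definition generated_shift (tau : nat -> morph) (x : config) : Prop :=
  forall (i : int) (n : nat), exists (k : nat) (a : letter),
    infix (window x i n) (tprod tau 0 k [:: a]).

Definition dir_seq (p0 : {perm letter}) (sigma : nat -> morph) : nat -> morph :=
  fun n => match n with 0 => perm_morph p0 | n'.+1 => sigma n' end.

(* Main.v *)
(* Each morphism of S_3 sends the letters to the words 1u followed by 1 in the image,
   i.e. it codes return words to the letter 1. Hence a word of the image containing 1
   is t F(v) 1 p for a unique v, and its extension graph is the image of the one of v
   by two partial maps on letters, each of which is injective, merges two letters or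
   forgets one. In a tree with three left and three right vertices such an operation
   yields a tree exactly when the two letters kept together have a common neighbour;
   the letter violating this, on either side, is unique in a dendric shift, because
   the words with three left extensions form a chain, and it is recorded by the
   vertices of G'. This gives dendricity by induction on the length of words.
   Conversely, the extension graph of the empty word is a strongly connected spanning
   tree of K_{3,3}; up to renaming there are exactly six of them, one for each family
   of S_3, and they determine the return words to 1 (for delta and zeta, the trees of
   the words 3^j force two consecutive run lengths k and k+1), so that the shift can be
   desubstituted forever. *)
Require Import Defs.
From mathcomp Require Import all_boot all_order all_algebra all_fingroup.
From mathcomp Require Import boolp zify.
Set Implicit Arguments. Unset Strict Implicit. Unset Printing Implicit Defensive.

(** An extension graph is one of 512 boolean 3 x 3 matrices, so every claim about a single graph is
    settled by enumeration, and only the parsing of image words is argued by hand. The parameter k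
    of delta and zeta does not spoil this: the partial maps on letters that are not constant do not
    depend on k. The two directions use a vertex of G' differently. For sufficiency it only has to
    bound the exceptional letters ([good]), which an induction on length can carry. For necessity an
    edge demands the equality [img s v' = Some v], so the vertex must be exactly the pair of
    exceptional letters ([bad_type]), and every letter produced by [img] has to be shown exceptional
    for some word. The argument lives on languages. Configurations appear only at both ends, where
    minimality is traded for uniform recurrence. Recurrence is also what bounds the runs of a
    letter, makes the graph of the empty word strongly connected, and makes the lengths of the
    compositions grow, whence primitivity. *)

Lemma letterP (a : letter) : [\/ a = l1, a = l2 | a = l3].
Proof.
by case: a => [[|[|[|m]]] lt_m] //; [constructor 1|constructor 2|constructor 3];
  apply: val_inj.
Qed.

Lemma letter_ext (T : Type) (f g : letter -> T) :
  f l1 = g l1 -> f l2 = g l2 -> f l3 = g l3 -> f = g.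
Proof. by move=> h1 h2 h3; apply/funext => a; case: (letterP a) => ->. Qed.

Definition letters : seq letter := [:: l1; l2; l3].

(** * Exhaustive checks over functions and boolean matrices on the alphabet *)

Definition lfun (T : Type) (x y z : T) : letter -> T :=
  fun a => match nat_of_ord a with 0 => x | 1 => y | _ => z end.

(** Extensionality identifies a function with its table of three values, so running through the
    tables runs through all functions. *)
Lemma lfunE (T : Type) (f : letter -> T) : f = lfun (f l1) (f l2) (f l3).
Proof. by apply/funext => a; case: (letterP a) => ->. Qed.

Notation mat := (letter -> letter -> bool).

Definition allbool (P : pred bool) : bool := P true && P false.

Lemma allboolP (P : pred bool) : allbool P -> forall b, P b.
Proof. by case/andP => Pt Pf []. Qed.

Definition allrow (P : pred (letter -> bool)) : bool :=
  allbool (fun x => allbool (fun y => allbool (fun z => P (lfun x y z)))).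

Lemma allrowP (P : pred (letter -> bool)) : allrow P -> forall f, P f.
Proof.
move=> h f; rewrite (lfunE f).
exact: allboolP (allboolP (allboolP h (f l1)) (f l2)) (f l3).
Qed.

Definition allmat (P : pred mat) : bool :=
  allrow (fun x => allrow (fun y => allrow (fun z => P (lfun x y z)))).

Lemma allmatP (P : pred mat) : allmat P -> forall e, P e.
Proof.
move=> h e; rewrite (lfunE e).
exact: allrowP (allrowP (allrowP h (e l1)) (e l2)) (e l3).
Qed.

(* Conditionals, because [vm_compute] evaluates both arguments of [&&] and [||]. *)
Definition exl (P : pred letter) : bool := if P l1 then true else if P l2 then true else P l3.
Definition alll (P : pred letter) : bool := if P l1 then if P l2 then P l3 else false else false.

Lemma exlP (P : pred letter) : reflect (exists a, P a) (exl P).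
Proof.
apply: (iffP idP) => [|[a]]; last by case: (letterP a) => -> Pa; rewrite /exl Pa ?if_same.
rewrite /exl; case: ifP => [?|_]; first by exists l1.
by case: ifP => [?|_ ?]; [exists l2|exists l3].
Qed.

Lemma alllP (P : pred letter) : reflect (forall a, P a) (alll P).
Proof.
apply: (iffP idP) => [|h]; last by rewrite /alll !h.
by rewrite /alll; case: ifP => // P1; case: ifP => // P2 P3 a; case: (letterP a) => ->.
Qed.

Definition allopt (P : pred (option letter)) : bool := P None && alll (fun a => P (Some a)).

Lemma alloptP (P : pred (option letter)) : allopt P -> forall o, P o.
Proof. by case/andP=> Pn /alllP Pa [a|]. Qed.

(** * Bipartite graphs on two copies of the alphabet *)

Definition mtr (e : mat) : mat := fun a b => e b a.
Definition nonempty (e : mat) : bool := exl (fun a => exl (e a)).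
Definition present (e : mat) (a : letter) : bool := exl (e a).
Definition share (e : mat) (a b : letter) : bool := exl (fun d => if e a d then e b d else false).
(* Three left vertices: two steps of [share] suffice to reach a whole component. *)
Definition linked (e : mat) (a b : letter) : bool :=
  if share e a b then true else exl (fun c => if share e a c then share e c b else false).
Definition connected (e : mat) : bool :=
  alll (fun a => if present e a then
    alll (fun b => if present e b then linked e a b else true) else true).
Definition suml (f : letter -> nat) : nat := f l1 + f l2 + f l3.
(** A tree by counting: connected, with one edge fewer than vertices. Testing connectivity between
    left vertices is enough, since a present right vertex has a left neighbour. *)
Definition treeb (e : mat) : bool :=
  if ~~ nonempty e then false else if ~~ connected e then false else
  (suml (fun a => suml (fun b => e a b)) + 1 ==
   suml (fun a => present e a) + suml (fun b => present (mtr e) b)).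

(** If the other two letters [b] and [c] of a tree have no common neighbour, merging them creates a
    cycle and deleting [a] disconnects them: the obstruction is the same for both operations. *)
Definition lbad (e : mat) (a : letter) : bool :=
  exl (fun b => exl (fun c =>
    if [|| b == a, c == a | b == c] then false else
    if present e b then if present e c then ~~ share e b c else false else false)).
Definition rbad (e : mat) (b : letter) : bool := lbad (mtr e) b.

(* A vertex [l, r] of the paper's graph stands for the only left letter [l] and the
   only right letter [r] whose removal may disconnect the other two letters, [None]
   excluding them all. *)
Definition good (e : mat) (v : vtx) : bool :=
  [&& treeb e, alll (fun a => lbad e a ==> (v.1 == Some a)) &
      alll (fun b => rbad e b ==> (v.2 == Some b))].

Definition no4cycle (e : mat) : bool :=
  alll (fun a => alll (fun b => if e a b then
  alll (fun a' => if e a' b then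
  alll (fun b' => if e a b' then if e a' b' then (a == a') || (b == b')
    else true else true) else true) else true)).
Definition no6cycle (e : mat) : bool :=
  alll (fun a1 => alll (fun b1 => if e a1 b1 then
  alll (fun a2 => if e a2 b1 then
  alll (fun b2 => if e a2 b2 then
  alll (fun a3 => if e a3 b2 then
  alll (fun b3 => if e a3 b3 then if e a1 b3 then
    ~~ (uniq [:: a1; a2; a3] && uniq [:: b1; b2; b3])
    else true else true) else true) else true) else true) else true)).

(** In a subgraph of K_{3,3} a cycle has length 4 or 6. This form is the one comparable with the
    definition of a tree by paths and cycles. *)
Lemma treeb_acyclic e :
  treeb e = [&& nonempty e, connected e, no4cycle e & no6cycle e].
Proof.
apply/eqP; move: e; apply: allmatP.
by vm_cast_no_check (erefl true).
Qed.

Lemma linked_share e a b c : linked e a b -> share e b c -> linked e a c.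
Proof.
suff /alllP /(_ a) /alllP /(_ b) /alllP /(_ c) h: alll (fun a => alll (fun b => alll (fun c =>
   if linked e a b then if share e b c then linked e a c else true else true))).
  by move: h => /[swap] -> /[swap] ->.
move: e; apply: allmatP.
by vm_cast_no_check (erefl true).
Qed.

Lemma treeb_4cycle e a a' b b' : treeb e ->
  e a b -> e a b' -> e a' b -> e a' b' -> a = a' \/ b = b'.
Proof.
rewrite treeb_acyclic => /and4P[_ _ h _] h1 h2 h3 h4.
move/alllP/(_ a)/alllP/(_ b): h; rewrite h1 => /alllP/(_ a'); rewrite h3.
by move/alllP/(_ b'); rewrite h2 h4 => /orP[] /eqP; [left|right].
Qed.

(** With two bad letters, the third would have no common neighbour with either of them, against
    connectedness. *)
Lemma lbad_uniq e a a' : treeb e -> lbad e a -> lbad e a' -> a = a'.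
Proof.
move=> te ba ba'.
suff /alllP/(_ a): alll (fun a => if lbad e a then
    alll (fun a' => if lbad e a' then a == a' else true) else true).
  by rewrite ba => /alllP/(_ a'); rewrite ba' => /eqP.
suff: if treeb e then alll (fun a => if lbad e a then
    alll (fun a' => if lbad e a' then a == a' else true) else true) else true.
  by rewrite te.
move: (e); apply: allmatP.
by vm_cast_no_check (erefl true).
Qed.

(** The two separated letters are joined through [a], hence all three left letters are present; a
    right vertex adjacent to all three would be a common neighbour of the separated two. *)
Lemma lbad_full e a : treeb e -> lbad e a ->
  alll (present e) /\ (forall b, ~~ alll (fun c => e c b)).
Proof.
move=> te ba.
suff: if treeb e then alll (fun a => if lbad e a then
    alll (present e) && alll (fun b => ~~ alll (fun c => e c b)) else true) else true.
  by rewrite te => /alllP/(_ a); rewrite ba => /andP[? /alllP].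
move: (e); apply: allmatP.
by vm_cast_no_check (erefl true).
Qed.

(** A single left vertex leaves no pair to separate, and a single right vertex is a common neighbour
    of every pair. Images under a constant partial map have this shape. *)
Lemma star_good e v : nonempty e ->
  (exists a, forall c b, e c b -> c = a) \/ (exists b, forall a c, e a c -> c = b) ->
  good e v.
Proof.
move=> ne st.
have {}st: exl (fun a => alll (fun c => alll (fun b => e c b ==> (c == a)))) ||
           exl (fun b => alll (fun a => alll (fun c => e a c ==> (c == b)))).
  case: st => [[a h]|[b h]]; apply/orP; [left|right]; apply/exlP; [exists a|exists b];
    by apply/alllP => c; apply/alllP => d; apply/implyP => /h ->.
suff: if nonempty e then if exl (fun a => alll (fun c => alll (fun b => e c b ==> (c == a)))) ||
           exl (fun b => alll (fun a => alll (fun c => e a c ==> (c == b)))) then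
  [&& treeb e, alll (fun a => ~~ lbad e a) & alll (fun b => ~~ rbad e b)] else true else true.
  rewrite ne st /good => /and3P[-> /alllP hl /alllP hr] /=.
  by apply/andP; split; apply/alllP => a; [rewrite (negPf (hl a))|rewrite (negPf (hr a))].
move: (e); apply: allmatP.
by vm_cast_no_check (erefl true).
Qed.

(** * The six families of morphisms on extension graphs *)

Notation pmap3 := (letter -> option letter).

(* [Lam s] (resp. [Rho s]) lists the non-constant partial maps sending a letter
   [c] to the letter read just before a suffix [t] of [l1 :: u c] (resp. just
   after a prefix of [u c ++ [:: l1]]), where [l1 :: u c] is the image of [c]. *)
Definition opt3 (a b c : nat) : pmap3 :=
  let o n := match n with 1 => Some l1 | 2 => Some l2 | 3 => Some l3 | _ => None end in
  lfun (o a) (o b) (o c).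

Definition Lam (s : S3) : seq pmap3 :=
  match s with
  | Salpha | Sgamma => [:: opt3 1 2 3]
  | Sbeta => [:: opt3 1 2 2; opt3 0 1 3]
  | Sdelta _ => [:: opt3 1 3 3; opt3 0 2 3]
  | Szeta _ => [:: opt3 3 2 3; opt3 1 0 3]
  | Seta => [:: opt3 3 2 3; opt3 1 0 2]
  end.

Definition Rho (s : S3) : seq pmap3 :=
  match s with
  | Salpha | Sbeta => [:: opt3 1 2 3]
  | Sgamma | Sdelta _ => [:: opt3 1 2 2; opt3 0 1 3]
  | Szeta _ => [:: opt3 3 2 3; opt3 1 0 3]
  | Seta => [:: opt3 3 2 2; opt3 0 1 3]
  end.

Definition imgm (f g : pmap3) (e : mat) : mat := fun a b =>
  exl (fun a' => if f a' == Some a then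
    exl (fun b' => if g b' == Some b then e a' b' else false) else false).

(** The graph of the empty word in the image language, read off the two-letter factors of the images
    followed by [l1]. It is the same for all k >= 1. *)
Definition base (s : S3) : mat := fun a b => (a, b) \in
  match s with
  | Salpha => [:: (l1, l1); (l1, l2); (l1, l3); (l2, l1); (l3, l1)]
  | Sbeta => [:: (l1, l1); (l1, l2); (l1, l3); (l3, l2); (l2, l1)]
  | Sgamma => [:: (l1, l1); (l1, l2); (l2, l3); (l2, l1); (l3, l1)]
  | Sdelta _ => [:: (l1, l1); (l1, l2); (l2, l3); (l3, l3); (l3, l1)]
  | Szeta _ => [:: (l1, l3); (l1, l2); (l3, l3); (l3, l1); (l2, l1)]
  | Seta => [:: (l1, l3); (l1, l2); (l2, l3); (l3, l1); (l2, l1)]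
  end.

Definition img_def (s : S3) (v : vtx) : bool := img s v != None.

(* Evaluates the entries of a matrix once and for all under [vm_compute]. *)
Definition tab (e : mat) : mat :=
  lfun (lfun (e l1 l1) (e l1 l2) (e l1 l3))
       (lfun (e l2 l1) (e l2 l2) (e l2 l3))
       (lfun (e l3 l1) (e l3 l2) (e l3 l3)).

Lemma tabE e : tab e = e.
Proof. by rewrite /tab -!lfunE. Qed.

(** An empty image belongs to a word outside the image language, so it is exempted. *)
Definition allimg (s : S3) (P : mat -> bool) (e : mat) : bool :=
  all (fun f => all (fun g => let e' := tab (imgm f g e) in
     if nonempty e' then P e' else true) (Rho s)) (Lam s).

Lemma good_allimg s v v' e : good e v' -> img s v' = Some v ->
  allimg s (good ^~ v) e.
Proof.
case: v v' => [l r] [l' r'].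
suff: if treeb e then allopt (fun l' => if alll (fun a => lbad e a ==> (l' == Some a)) then
    allopt (fun r' => if alll (fun a => rbad e a ==> (r' == Some a)) then
      if img s (l', r') is Some v then allimg s (good ^~ v) e else true else true)
    else true) else true.
  move=> h /and3P[te gl gr]; move: h; rewrite te => /alloptP/(_ l'); rewrite gl.
  by move=> /alloptP/(_ r'); rewrite gr => /[swap] ->.
(* [Lam], [Rho] and [img] ignore k, so the enumeration computes with k a variable. *)
by case: s => [||| k|k|]; move: (e); apply: allmatP; vm_cast_no_check (erefl true).
Qed.

(** Used for necessity. The domain of [img] is given by one condition on l and one on r, so each
    side is tested with [None] on the other, and [img_def_split] recombines them. *)
Lemma allimg_treeb s e : nonempty e -> allimg s treeb e ->
  [/\ treeb e, forall a, lbad e a -> img_def s (Some a, None) &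
      forall b, rbad e b -> img_def s (None, Some b)].
Proof.
move=> ne te.
suff: if nonempty e then if allimg s treeb e then
   [&& treeb e, alll (fun a => lbad e a ==> img_def s (Some a, None)) &
      alll (fun b => rbad e b ==> img_def s (None, Some b))] else true else true.
  rewrite ne te => /and3P[-> /alllP hl /alllP hr].
  by split=> // a; apply/implyP.
by case: s {te} => [||| k|k|]; move: (e); apply: allmatP; vm_cast_no_check (erefl true).
Qed.

Lemma img_def_split s l r : img_def s (l, None) -> img_def s (None, r) -> img_def s (l, r).
Proof. by case: s => [||| k|k|] //=; rewrite /img_def /=; do ?case: ifP => //. Qed.

Lemma base_good s v v' : img s v' = Some v -> good (base s) v.
Proof.
case: v' => l r.
suff /alloptP/(_ l)/alloptP/(_ r): allopt (fun l => allopt (fun r =>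
     if img s (l, r) is Some v then good (base s) v else true)) by move=> /[swap] ->.
by case: s => [||| k|k|]; vm_compute.
Qed.

Definition anyimg (s : S3) (P : mat -> bool) (e : mat) : bool :=
  has (fun f => has (fun g => P (tab (imgm f g e))) (Rho s)) (Lam s).

(** Sharpness of [img]: a letter that it produces is either bad for the empty word of the image, or
    was bad before and stays bad in one of the images. *)
Lemma img_lbad s v' l r a : img s v' = Some (l, r) -> l = Some a ->
  lbad (base s) a \/
  (v'.1 = Some a /\ forall e, lbad e a -> anyimg s (lbad ^~ a) e).
Proof.
case: v' => l' r' h la; subst l.
suff /alloptP/(_ l')/alloptP/(_ r'): allopt (fun l' => allopt (fun r' =>
     if img s (l', r') is Some (Some a, _) then lbad (base s) a || ((l' == Some a) &&
       allmat (fun e => if lbad e a then anyimg s (lbad ^~ a) e else true)) else true)).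
  rewrite h => /orP[|/andP[/eqP la /allmatP he]]; [by left|right].
  by split=> // e ea; move: (he e); rewrite ea.
by case: s {h} => [||| k|k|]; vm_cast_no_check (erefl true).
Qed.

Lemma img_rbad s v' l r a : img s v' = Some (l, r) -> r = Some a ->
  rbad (base s) a \/
  (v'.2 = Some a /\ forall e, rbad e a -> anyimg s (rbad ^~ a) e).
Proof.
case: v' => l' r' h la; subst r.
suff /alloptP/(_ l')/alloptP/(_ r'): allopt (fun l' => allopt (fun r' =>
     if img s (l', r') is Some (_, Some a) then rbad (base s) a || ((r' == Some a) &&
       allmat (fun e => if rbad e a then anyimg s (rbad ^~ a) e else true)) else true)).
  rewrite h => /orP[|/andP[/eqP la /allmatP he]]; [by left|right].
  by split=> // e ea; move: (he e); rewrite ea.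
by case: s {h} => [||| k|k|]; vm_cast_no_check (erefl true).
Qed.

Definition pmat (f : letter -> letter) (e : mat) : mat := fun a b => e (f a) (f b).

Definition perms3 : seq (letter -> letter) :=
  [:: lfun l1 l2 l3; lfun l1 l3 l2; lfun l2 l1 l3; lfun l2 l3 l1; lfun l3 l1 l2; lfun l3 l2 l1].

Lemma perms3_perm k : k < 6 -> exists p : {perm letter}, forall a, p a = nth id perms3 k a.
Proof.
move=> lt_k; have inj : injective (nth id perms3 k).
  by move: k lt_k => [|[|[|[|[|[|//]]]]]] _ a b; case: (letterP a) => ->; case: (letterP b) => ->.
by exists (perm inj) => a; rewrite permE.
Qed.

(** Strong connectivity of the digraph of two-letter words, in cut form. *)
Definition strongly (e : mat) : bool :=
  allrow (fun S => [|| alll S, ~~ exl S | exl (fun a => exl (fun b => [&& S a, ~~ S b & e a b]))]).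

(** The value 1 of k is arbitrary, since [base] does not depend on it; the true k is found later
    from run lengths. *)
Definition S3reps := [:: Salpha; Sbeta; Sgamma; Sdelta 1; Szeta 1; Seta].

Lemma base_class e : treeb e -> alll (present e) -> alll (present (mtr e)) -> strongly e ->
  exists p s, pmat (fun_of_perm p) e = base s.
Proof.
move=> h1 h2 h3 h4.
have: if treeb e then if alll (present e) then if alll (present (mtr e)) then if strongly e then
   has (fun p => has (fun s => alll (fun a => alll (fun b => pmat (nth id perms3 p) e a b ==
       base s a b))) S3reps) (iota 0 6)
   else true else true else true else true.
  by move: (e); apply: allmatP; vm_cast_no_check (erefl true).
rewrite h1 h2 h3 h4 => /hasP[k]; rewrite mem_iota => /andP[_ /perms3_perm[p hp]].
elim: S3reps => //= s ss IH /orP[h|]; last exact: IH.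
exists p, s; apply/funext => a; apply/funext => b; rewrite /pmat !hp.
by move: h => /alllP/(_ a)/alllP/(_ b)/eqP.
Qed.

(** * Languages *)

Notation language := (seq letter -> Prop).

(** Properties of the language of a shift space; conversely, [config_of_words] rebuilds
    configurations from such a language. *)
Record extendable (L : language) : Prop := Extendable {
  ext_fact : forall u w v, L (u ++ w ++ v) -> L w;
  ext_both : forall w, L w -> exists a b, L (a :: rcons w b);
  ext_letter : forall a, L [:: a] }.

Definition recurrent (L : language) : Prop :=
  forall w, L w -> exists N, forall v, L v -> N <= size v -> infix w v.

Definition emat (L : language) (w : seq letter) : mat :=
  fun a b => `[< L (a :: rcons w b) >].

Definition dendric_lang (L : language) : Prop := forall w, L w -> treeb (emat L w).

Section Extendable.
Variable (L : language).
Hypothesis eL : extendable L.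

Lemma lang_infix w v : infix w v -> L v -> L w.
Proof. by case/infixP=> [s1 [s2 ->]]; apply: ext_fact. Qed.

Lemma lang_catl w v : L (w ++ v) -> L w.
Proof. by apply: lang_infix; rewrite infix_catr ?infix_refl. Qed.

Lemma lang_catr w v : L (w ++ v) -> L v.
Proof. by apply: lang_infix; rewrite infix_catl ?infix_refl. Qed.

Lemma lang_nil : L [::].
Proof. exact: (@lang_catl [::] [:: l1]) (ext_letter eL l1). Qed.

Lemma lang_extr w : L w -> exists b, L (rcons w b).
Proof. by case/(ext_both eL) => a [b]; rewrite -cat1s => /lang_catr; exists b. Qed.

Lemma lang_extl w : L w -> exists a, L (a :: w).
Proof. by case/(ext_both eL) => a [b]; rewrite -rcons_cons -cats1 => /lang_catl; exists a. Qed.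

Lemma lang_extn w n : L w -> exists x y, [/\ size x = n, size y = n & L (x ++ w ++ y)].
Proof.
move=> Lw; elim: n => [|n [x [y [sx sy /(ext_both eL)[a [b Lab]]]]]].
  by exists [::], [::]; rewrite cats0.
exists (a :: x), (rcons y b); split=> /=; rewrite ?sx ?size_rcons ?sy //.
by move: Lab; rewrite !rcons_cat.
Qed.

Lemma emat_nonempty w : L w -> nonempty (emat L w).
Proof.
case/(ext_both eL) => a [b Lab]; apply/exlP; exists a; apply/exlP; exists b.
exact/asboolP.
Qed.

Lemma nonempty_emat w : nonempty (emat L w) -> L w.
Proof.
case/exlP=> a /exlP[b /asboolP]; rewrite -cats1 -cat1s; exact: ext_fact.
Qed.

Lemma emat_presentl w a : present (emat L w) a = `[< L (a :: w) >].
Proof.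
apply/exlP/asboolP => [[b /asboolP]|/lang_extr[b Lb]]; last by exists b; apply/asboolP.
by rewrite -rcons_cons -cats1; apply: lang_catl.
Qed.

Lemma emat_presentr w b : present (mtr (emat L w)) b = `[< L (rcons w b) >].
Proof.
apply/exlP/asboolP => [[a /asboolP]|/lang_extl[a La]]; last by exists a; apply/asboolP.
by rewrite -cat1s; apply: lang_catr.
Qed.

End Extendable.

(** * Words coded by return words to [l1] *)

Definition imL (f : morph) (L : language) : language :=
  fun w => exists2 v, L v & infix w (apply_morph f v).

Lemma apply_morph_cat f u v : apply_morph f (u ++ v) = apply_morph f u ++ apply_morph f v.
Proof. by rewrite /apply_morph map_cat flatten_cat. Qed.

Lemma apply_morph_cons f a v : apply_morph f (a :: v) = f a ++ apply_morph f v.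
Proof. by []. Qed.

Lemma apply_morph_rcons f v a : apply_morph f (rcons v a) = apply_morph f v ++ f a.
Proof. by rewrite -cats1 apply_morph_cat /apply_morph /= cats0. Qed.

Lemma split_uniq (T : eqType) (c : T) p q x y :
  c \notin p -> c \notin q -> p ++ c :: x = q ++ c :: y -> p = q /\ x = y.
Proof.
elim: p q => [|a p IH] [|b q] //=.
- by move=> _ _ [->].
- by move=> _ /[swap] -[-> _]; rewrite inE eqxx.
- by move=> /[swap] _ /[swap] -[-> _]; rewrite inE eqxx.
by rewrite !inE !negb_or => /andP[_ cp] /andP[_ cq] [-> /(IH _ cp cq)[-> ->]].
Qed.

Lemma cat_prefix (T : eqType) (s1 s2 t1 t2 : seq T) : s1 ++ s2 = t1 ++ t2 ->
  size s1 <= size t1 -> exists2 r, t1 = s1 ++ r & s2 = r ++ t2.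
Proof.
elim: s1 t1 => [|a s1 IH] t1 /= E lt; first by exists t1.
by case: t1 lt E => //= b t1 lt [-> E]; have [r -> ->] := IH _ E lt; exists r.
Qed.

Lemma prefix_to (T : eqType) (c : T) q r w b y : c \notin w -> c \notin q ->
  q ++ c :: r = w ++ b :: y -> prefix (rcons w b) (rcons q c).
Proof.
elim: q w => [|a q IH] [|d w] //=.
- by move=> _ _ [<- _]; rewrite eqxx.
- by move=> /[swap] _ /[swap] -[-> _]; rewrite inE eqxx.
- by move=> _ _ [<- _]; rewrite eqxx prefix0s.
by rewrite !inE !negb_or => /andP[_ cp] /andP[_ cq] [-> E]; rewrite eqxx /= (IH w) //.
Qed.

Definition return_code (u : letter -> seq letter) : morph := fun a => l1 :: u a.

Section ReturnCode.
Variable (u : letter -> seq letter).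
Hypothesis u1 : forall a, l1 \notin u a.
Hypothesis u_inj : injective u.
Local Notation f := (return_code u).
Local Notation F := (apply_morph f).

Lemma F_head v : F v = [::] \/ exists r, F v = l1 :: r.
Proof. by case: v => [|a v]; [left|right; exists (u a ++ F v)]. Qed.

Lemma F_tail v r : exists r', F v ++ l1 :: r = l1 :: r'.
Proof. by case: (F_head v) => [->|[s ->]]; [exists r|exists (s ++ l1 :: r)]. Qed.

Lemma F_size v : size v <= size (F v).
Proof.
elim: v => // a v IH; rewrite apply_morph_cons size_cat /= addSn ltnS.
exact: leq_trans IH (leq_addl _ _).
Qed.

(** An image of a letter contains [l1] only as its first letter, so every occurrence of [l1] is a
    boundary between blocks. *)
Lemma F_parse z x y : F z = x ++ l1 :: y ->
  exists z1 z2, [/\ z = z1 ++ z2, F z1 = x & F z2 = l1 :: y].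
Proof.
elim: z x => [|c z IH] [|a x] //.
  by exists [::], (c :: z).
rewrite apply_morph_cons /= => -[<- E].
have [r Ex Ez]: exists2 r, x = u c ++ r & F z = r ++ l1 :: y.
  case: (leqP (size (u c)) (size x)) => sz; first exact: cat_prefix E sz.
  have [r Eu _] := cat_prefix (esym E) (ltnW sz).
  move: E (u1 c); rewrite Eu -catA => /(congr1 (drop (size x))).
  rewrite !drop_size_cat // mem_cat; case: r Eu => [Eu|b r _ [-> _]].
    by rewrite Eu cats0 ltnn in sz.
  by rewrite inE eqxx orbT.
have [z1 [z2 [-> E1 E2]]] := IH _ Ez.
by exists (c :: z1), z2; rewrite apply_morph_cons E1 Ex.
Qed.

(** A block is determined by the letters up to the next [l1], so injectivity of [u] matches the
    blocks one by one. *)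
Lemma F_cancel v z y : F z = F v ++ l1 :: y ->
  exists z', z = v ++ z' /\ F z' = l1 :: y.
Proof.
elim: v z => [|d v IH] [|c z] //; first by exists (c :: z).
rewrite !apply_morph_cons /= -catA => -[E].
have [r Er] := F_tail v y; rewrite Er in E IH.
case: (F_head z) => [Ez|[s Es]].
  move: (u1 c) => /negP[]; move: E; rewrite Ez cats0 => ->.
  by rewrite mem_cat inE eqxx orbT.
rewrite Es in E; have [/u_inj -> Esr] := split_uniq (u1 c) (u1 d) E.
by have [z' [-> Fz']] := IH z (etrans Es (congr1 (cons l1) Esr)); exists z'.
Qed.

(** The trailing [l1] certifies that the last block is complete. Without it, a block that is a
    prefix of another one could be mistaken for it. *)
Lemma F_sync v z : infix (F v ++ [:: l1]) (F z) -> infix v z.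
Proof.
case/infixP=> [x [y]]; rewrite -catA /=.
have [r Er] := F_tail v y; rewrite Er => /F_parse[z1 [z2 [-> _]]].
rewrite -Er => /F_cancel[z' [-> _]].
by rewrite infix_catl // infix_catr // infix_refl.
Qed.

Variable L : language.
Hypothesis eL : extendable L.

Lemma imL_extendable : (forall a, imL f L [:: a]) -> extendable (imL f L).
Proof.
move=> h; split=> // [x w y [v Lv wv]|w [v Lv /infixP[x [y E]]]].
  by exists v => //; apply: infix_trans wv; rewrite infix_catl // infix_catr // infix_refl.
have [a [b Lab]] := ext_both eL Lv.
have fE : F (a :: rcons v b) = (l1 :: u a) ++ F v ++ (l1 :: u b).
  by rewrite apply_morph_cons -cats1 apply_morph_cat /apply_morph /= cats0.
have [s [c Es]] : exists s c, (l1 :: u a) ++ x = rcons s c.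
  by exists (belast l1 (u a ++ x)), (last l1 (u a ++ x)); rewrite /= lastI.
have [d [t Et]] : exists d t, y ++ (l1 :: u b) = d :: t.
  by case: y {E} => [|d t]; [exists l1, (u b)|exists d, (t ++ l1 :: u b)].
exists c, d, (a :: rcons v b) => //; rewrite fE E; apply/infixP; exists s, t.
by rewrite !catA Es -!catA Et cat_rcons /= cat_rcons.
Qed.

Lemma imL_cut w : imL f L w -> l1 \in w ->
  exists t v p, [/\ w = t ++ F v ++ l1 :: p, l1 \notin t, l1 \notin p & L v].
Proof.
case=> z Lz /infixP[x [y Ez]] w1.
have Et : exists t w2, w = t ++ l1 :: w2 /\ l1 \notin t.
  case/splitPr: w1 Ez => p1 p2 _.
  elim: p1 => [|a p1 [t [w2 [E nt]]]]; first by exists [::], p2.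
  case: (a =P l1) => [->|/eqP ne]; first by exists [::], (p1 ++ l1 :: p2).
  by exists (a :: t), w2; rewrite /= E inE negb_or nt eq_sym ne.
have Ep : forall w2, exists w3 p, l1 :: w2 = w3 ++ l1 :: p /\ l1 \notin p.
  elim/last_ind => [|w2 a [w3 [p [E np]]]]; first by exists [::], [::].
  case: (a =P l1) => [->|/eqP ne]; first by exists (l1 :: w2), [::]; rewrite -cats1.
  exists w3, (rcons p a); rewrite -rcons_cons E rcons_cat; split=> //.
  by rewrite mem_rcons inE negb_or np eq_sym ne.
have [t [w2 [Ew nt]]] := Et; have [w3 [p [E3 np]]] := Ep w2.
move: Ez; rewrite Ew -!catA E3 => Ez.
have [r Er] : exists r, (w3 ++ l1 :: p) ++ y = l1 :: r by rewrite -E3; exists (w2 ++ y).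
have Lsub z1 z2 : z = z1 ++ z2 -> L z2 by move=> E; apply: (lang_catr eL) (_ : L (z1 ++ z2));
    rewrite -E.
move: Ez; rewrite Er catA => /F_parse[z1 [z2 [Hz _]]].
rewrite -Er -catA => /F_parse[v [z3 [Hv Fv _]]].
exists t, v, p; rewrite Fv; split=> //.
by apply: (lang_catl eL) (_ : L (v ++ z3)); rewrite -Hv; apply: Lsub Hz.
Qed.

(* When [p] exhausts [v], the next letter is the [l1] opening the next image. *)
Fixpoint nxt (p v : seq letter) : option letter :=
  match p, v with
  | [::], _ => Some (head l1 v)
  | x :: p', y :: v' => if x == y then nxt p' v' else None
  | _ :: _, [::] => None
  end.

Lemma nxtP p v b : l1 \notin p -> (nxt p v == Some b) = prefix (rcons p b) (rcons v l1).
Proof.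
elim: p v => [|x p IH] [|y v] /=; rewrite ?prefix0s ?andbT.
- by move=> _; rewrite eq_sym.
- by move=> _; rewrite eq_sym.
- by rewrite inE negb_or eq_sym => /andP[/negPf-> _].
- by rewrite inE negb_or => /andP[_ /IH h]; case: (x =P y) => // _; rewrite h.
Qed.

(** Reading goes backwards here, and the default [l1] of [nxt] is the first letter of the image of
    [a] itself. *)
Definition lmap (t : seq letter) : pmap3 := fun a => nxt (rev t) (rev (u a)).
Definition rmap (p : seq letter) : pmap3 := fun b => nxt p (u b).

Lemma rev_prefix_suffix (s1 s2 : seq letter) : prefix (rev s1) (rev s2) = suffix s1 s2.
Proof. by rewrite prefix_rev. Qed.

Lemma lmapP t a a' : l1 \notin t -> (lmap t a' == Some a) = suffix (a :: t) (f a').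
Proof.
move=> nt; rewrite /lmap nxtP ?mem_rev //.
by rewrite -!rev_cons rev_prefix_suffix.
Qed.

(** The last [l1] opens the image of the letter [b'] following [v], with [p] a prefix of [u b'], and
    [t] is a suffix of the image of the letter [a'] preceding [v]. Hence the two partial maps carry
    the edges of [v] to the edges of the longer word. *)
Lemma imL_emat_cut t v p : l1 \notin t -> l1 \notin p ->
  emat (imL f L) (t ++ F v ++ l1 :: p) = imgm (lmap t) (rmap p) (emat L v).
Proof.
move=> nt np; apply/funext => a; apply/funext => b; apply/asboolP/exlP.
  case=> z Lz /infixP[x [y Ez]].
  have {}Ez : F z = (x ++ a :: t) ++ F v ++ l1 :: (p ++ b :: y).
    by rewrite Ez -cats1 -!catA /= -!catA /= -catA.
  have [r Er] := F_tail v (p ++ b :: y).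
  move: Ez; rewrite Er => /F_parse[z1 [z2 [Hz F1]]].
  rewrite -Er => /F_cancel[z3 [Hz2 F3]].
  case/lastP: z1 F1 Hz => [|z1 a'] F1 Hz; first by case: (x) F1.
  case: z3 F3 Hz2 => [//|b' z3] F3 Hz2.
  exists a'; rewrite (lmapP _ _ nt).
  have -> : suffix (a :: t) (f a').
    move: F1; rewrite -cats1 apply_morph_cat /apply_morph /= cats0 => F1.
    have := F1 => /(congr1 rev); rewrite !rev_cat !rev_cons -!cats1 -!catA /= => E.
    rewrite -rev_prefix_suffix !rev_cons.
    apply: (@prefix_to _ l1 _ (rev (F z1)) _ _ (rev x)); rewrite ?mem_rev ?u1 //.
  apply/exlP; exists b'; rewrite /rmap nxtP //.
  have -> : prefix (rcons p b) (rcons (u b') l1).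
    move: F3; rewrite apply_morph_cons /= => -[F3].
    case: (F_head z3) F3 => [->|[s ->]] F3; last exact: prefix_to F3.
    by apply: (@prefix_to _ l1 _ [::] _ _ (rcons y l1)); rewrite ?u1 // -rcons_cons -rcons_cat
        -F3 cats0 cats1.
  apply/asboolP; apply: (ext_fact eL (u := z1) (v := z3)).
  by move: Lz; rewrite Hz Hz2 -cats1 -!catA /= -cats1 -catA.
case=> a'; case: ifP => // /[!lmapP]// sa /exlP[b']; rewrite /rmap nxtP //.
(* The extra letter [c] provides the [l1] that follows the image of [b'], needed when [p] is all of
   [u b']. *)
case: ifP => // pb /asboolP /(lang_extr eL)[c Lc].
exists (rcons (a' :: rcons v b') c) => //.
have -> : F (rcons (a' :: rcons v b') c) = f a' ++ F v ++ f b' ++ f c.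
  by rewrite -!cats1 /= -!catA apply_morph_cons !apply_morph_cat /apply_morph /= !cats0.
case/suffixP: sa => x ->; case/prefixP: pb => y Ey.
have Ebc : f b' ++ f c = l1 :: (rcons p b ++ y) ++ u c by rewrite -Ey /= cat_rcons.
apply/infixP; exists x, (y ++ u c).
by rewrite Ebc -!cats1 -!catA /= -!catA /= -?catA.
Qed.

(** Only the end letters of [a w b] can be [l1], and each [l1] opens a block, so the word fits in
    one block followed by the [l1] of the next. *)
Lemma imL_emat_free w a b : l1 \notin w ->
  emat (imL f L) w a b = exl (fun c => infix (a :: rcons w b) (rcons (f c) l1)).
Proof.
move=> nw; apply/asboolP/exlP => [[z Lz wz]|[c wc]].
  have {wz}: infix (a :: rcons w b) (F z ++ [:: l1]).
    by apply: (infix_trans wz); rewrite infix_catr ?infix_refl.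
  elim: z {Lz} => [|c z IH]; first by case/infixP=> [[|? [|? x]] [y]] //= []; case: (w).
  rewrite apply_morph_cons -catA => /infixP[x [y Ez]].
  have [r Er] := F_tail z [::].
  case: (leqP (size (f c)) (size x)) => sz.
    have [x' _ E'] := cat_prefix Ez sz; apply: IH.
    by apply/infixP; exists x', y.
  have [q Eq E'] := cat_prefix (esym Ez) (ltnW sz).
  case: q Eq E' => [Eq|d q Eq /= [Ed E']]; first by rewrite Eq cats0 ltnn in sz.
  have nq : l1 \notin q.
    move: (u1 c); case: (x) Eq => [|x0 x'] [_ ->] //.
    by rewrite mem_cat inE !negb_or => /and3P[].
  rewrite Er cat_rcons in E'; move/esym in E'; exists c.
  suff: infix (a :: rcons w b) (rcons (f c) l1) by [].
  rewrite Eq -Ed.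
  rewrite rcons_cat /= infix_catl //= eqxx.
  by apply/orP; left; apply: prefix_to E'.
have [d Ld] := lang_extr eL (ext_letter eL c).
exists [:: c; d] => //; apply: infix_trans wc _.
by apply/infixP; exists [::], (u d); rewrite /apply_morph /= cats0 cat_rcons.
Qed.

End ReturnCode.

(** * Decoding a language by its return words to l1 *)

Section Decode.
Variable (u : letter -> seq letter).
Hypothesis u1 : forall a, l1 \notin u a.
Hypothesis u_inj : injective u.
Local Notation f := (return_code u).
Local Notation F := (apply_morph f).
Variable M : language.
Hypothesis eM : extendable M.
Hypothesis rM : recurrent M.
Hypothesis retM : forall q, l1 \notin q -> M (l1 :: rcons q l1) <-> exists c, q = u c.

Definition decL : language := fun v => M (F v ++ [:: l1]).

Lemma long_l1 : exists N, forall v, M v -> N <= size v -> l1 \in v.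
Proof.
have [N h] := rM (ext_letter eM l1); exists N => v Mv sv.
by have /mem_infix := h v Mv sv; apply; rewrite inE.
Qed.

Lemma split_first (v : seq letter) : l1 \in v -> exists t r, v = t ++ l1 :: r /\ l1 \notin t.
Proof.
elim: v => [|a v IH] //; rewrite inE; case: (l1 =P a) => [<- _|/eqP ne /= /IH].
  by exists [::], v.
by case=> t [r [-> nt]]; exists (a :: t), r; rewrite inE negb_or ne.
Qed.

Lemma split_last (v : seq letter) : l1 \in v -> exists t r, v = t ++ l1 :: r /\ l1 \notin r.
Proof.
rewrite -mem_rev => /split_first[t [r [E nt]]]; exists (rev r), (rev t).
by rewrite -(revK v) E rev_cat rev_cons cat_rcons mem_rev.
Qed.

Lemma decode q : M (l1 :: rcons q l1) -> exists v, l1 :: q = F v.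
Proof.
elim: {q}(size q).+1 {-2}q (ltnSn (size q)) => // n IH q; rewrite ltnS => sq Mq.
case: (boolP (l1 \in q)) => [/split_first[t [r [Eq nt]]]|nq].
  have Mt : M (l1 :: rcons t l1).
    apply: (lang_catl eM) (_ : M (_ ++ rcons r l1)).
    by move: Mq; rewrite Eq rcons_cat /= cat_rcons.
  have Mr : M (l1 :: rcons r l1).
    by apply: (lang_catr eM) (_ : M ((l1 :: t) ++ _)); move: Mq; rewrite Eq rcons_cat.
  have [c Ec] := (retM nt).1 Mt.
  have [|v Ev] := IH r _ Mr.
    by apply: leq_trans sq; rewrite Eq size_cat /= addnS ltnS leq_addl.
  by exists (c :: v); rewrite apply_morph_cons -Ev Eq Ec.
have [c ->] := (retM nq).1 Mq.
by exists [:: c]; rewrite /apply_morph /= cats0.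
Qed.

Lemma decL_extendable : extendable decL.
Proof.
split=> [x w y|w Mw|a]; rewrite /decL.
- rewrite !apply_morph_cat -!catA => /(lang_catr eM).
  have [r ->] := F_tail u y [::]; rewrite -[l1 :: r]cat1s catA.
  exact: (lang_catl eM).
- have [N hN] := long_l1.
  (* The gaps between letters [l1] are bounded, so N extra letters on each side reach an [l1] on
     both. *)
  have [x [y [sx sy Mxy]]] := lang_extn eM N Mw.
  have [|x1 [x2 [Ex nx]]] := @split_last x.
    by apply: hN; rewrite ?sx //; apply: (lang_catl eM) Mxy.
  have [|y1 [y2 [Ey ny]]] := @split_first y.
    by apply: hN; rewrite ?sy //; move: Mxy; rewrite catA => /(lang_catr eM).
  move: Mxy; rewrite Ex Ey -!catA => /(lang_catr eM) M1.
  have [r Er] := F_tail u w (y1 ++ l1 :: y2).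
  have [a Ea] : exists a, x2 = u a.
    apply/retM => //; apply: (lang_catl eM (v := r)).
    by move: M1; rewrite /= -?catA /= Er -cat_rcons.
  have [b Eb] : exists b, y1 = u b.
    apply/retM => //; apply: (ext_fact eM (u := (l1 :: x2) ++ F w) (v := y2)).
    by rewrite /= cat_rcons -catA.
  exists a, b; rewrite apply_morph_cons apply_morph_rcons.
  apply: (lang_catl eM (v := y2)).
  by move: M1; rewrite Ea Eb -!catA /=.
by rewrite -[[:: a]]/(rcons [::] a) apply_morph_rcons /= cats1; apply/retM => //; exists a.
Qed.

Lemma decL_recurrent : recurrent decL.
Proof.
(* The last letter [c] is set aside: the [l1] opening its image closes the occurrence of [F w ++
   [:: l1]]. *)
move=> w /rM[N hN]; exists N.+1 => v; case/lastP: v => [//|v c].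
rewrite size_rcons ltnS /decL => Mv sv.
have {}hN : infix (F w ++ [:: l1]) (F v ++ [:: l1]).
  apply: hN.
    apply: (lang_catl eM (v := u c ++ [:: l1])).
    by move: Mv; rewrite apply_morph_rcons -!catA.
  rewrite size_cat addn1; apply: leq_trans sv _; apply: leqW.
  exact: F_size.
have /(F_sync u1 u_inj) : infix (F w ++ [:: l1]) (F (rcons v c)).
  apply: infix_trans hN _.
  by apply/infixP; exists [::], (u c); rewrite apply_morph_rcons -catA.
by [].
Qed.

Lemma imL_decL w : M w <-> imL f decL w.
Proof.
split=> [Mw|[v Mv wv]]; last by apply: (lang_infix eM) Mv; rewrite infix_catr.
have [N hN] := long_l1.
have [x [y [sx sy Mxy]]] := lang_extn eM N Mw.
have [|x1 [x2 [Ex nx]]] := @split_last x.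
  by apply: hN; rewrite ?sx //; apply: (lang_catl eM) Mxy.
have [|y1 [y2 [Ey ny]]] := @split_first y.
  by apply: hN; rewrite ?sy //; move: Mxy; rewrite catA => /(lang_catr eM).
have M1 : M (l1 :: rcons (x2 ++ w ++ y1) l1).
  apply: (ext_fact eM (u := x1) (v := y2)).
  by move: Mxy; rewrite Ex Ey -!catA /= cat_rcons -!catA.
have [v Ev] := decode M1; exists v.
  by rewrite /decL -Ev cats1.
by rewrite -Ev; apply/infixP; exists (l1 :: x2), y1.
Qed.

End Decode.

(** * Partial letter maps induced by the six families *)

Definition ucode (s : S3) : letter -> seq letter := fun a => behead (S3_morph s a).

Lemma S3_morphE s : S3_morph s = return_code (ucode s).
Proof. by apply/funext => a; case: s => [||| k|k|]; case: (letterP a) => ->. Qed.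

Lemma ucode_l1 s a : l1 \notin ucode s a.
Proof.
by case: s => [||| k|k|]; case: (letterP a) => -> //=; rewrite /ucode /= ?inE ?mem_nseq ?andbF.
Qed.

Lemma ucode_inj s : injective (ucode s).
Proof.
move=> a b; rewrite /ucode; case: s => [||| k|k|]; case: (letterP a) => ->;
  case: (letterP b) => -> //= E.
all: try by move: (congr1 size E); rewrite /= ?size_nseq //; move/eqP; rewrite ?eqSS ?(ltn_eqF
    (ltnSn _)) ?(gtn_eqF (ltnSn _)).
all: by case: k E => [|k] //= [].
Qed.

Definition single (f : pmap3) : Prop := forall c c' a a', f c = Some a -> f c' = Some a' -> a = a'.

(** Runs of lengths k and k + 1 followed by the same [T] are separated by the next letter only after
    exactly k letters [l3]. This is why the lists of non-constant maps do not depend on k. *)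
Lemma nxt_runs T k p : head l1 T != l3 ->
  (forall a b, nxt p (nseq k l3 ++ T) = Some a -> nxt p (nseq k.+1 l3 ++ T) = Some b -> a = b)
  \/ (nxt p (nseq k l3 ++ T) = Some (head l1 T) /\ nxt p (nseq k.+1 l3 ++ T) = Some l3).
Proof.
move=> hT; elim: k p => [|k IH] [|x p] /=; [by right| |by left=> a b [<-] [<-]|].
  left=> a b; case: T hT => [|t T] //= tT; case: eqP => // ->.
  by rewrite (negPf tT).
by case: eqP => _; [exact: IH|left].
Qed.

Lemma single3 (f : pmap3) :
  (forall a b, f l1 = Some a -> f l2 = Some b -> a = b) ->
  (forall a b, f l1 = Some a -> f l3 = Some b -> a = b) ->
  (forall a b, f l2 = Some a -> f l3 = Some b -> a = b) -> single f.
Proof.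
move=> h12 h13 h23 c c' a a'.
case: (letterP c) => ->; case: (letterP c') => -> E E';
 by [move: E'; rewrite E => -[]|apply: h12|apply: h13|apply: h23|apply/esym; apply:
     h12|apply/esym; apply: h13|apply/esym; apply: h23].
Qed.

Definition nopt : pmap3 := fun=> None.

(** Besides the empty prefix, only one prefix separates two letters: [l2] for gamma and eta, [l2]
    followed by 3^k for delta, 3^k for zeta, and none for alpha and beta. *)
Lemma rmap_cases s p : valid_S3 s -> single (rmap (ucode s) p) \/
  exists2 i, i < size (Rho s) & rmap (ucode s) p = nth nopt (Rho s) i.
Proof.
case: p => [|x p].
  by case: s => [||| [|k]|[|k]|] // _; right; exists 0 => //; apply: letter_ext.
case: s => [||| k|k|] //= k0.
- by left; apply: single3 => a b; case: (letterP x) => ->; case: p.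
- left; apply: single3 => a b; case: (letterP x) => ->; case: p => [|y [|z p]] //=;
   try case: (letterP y) => -> //=; by move=> [<-] [<-].
- case: p => [|y p]; first by case: (letterP x) => ->; [left; exact: single3|right; exists 1 =>
    //; apply: letter_ext|left; apply: single3].
  left; apply: single3 => a b; case: (letterP x) => ->; case: (letterP y) => -> //=; by case: p.
- case: (letterP x) => ->; [by left; apply: single3| |by left; apply: single3].
  case: (@nxt_runs [::] k p isT); rewrite !cats0 => h; [left|right].
    by apply: single3.
  by exists 1 => //; apply: letter_ext => //; case: h.
- case: k k0 => // k _; case: (letterP x) => ->; [by left; apply: single3|by left; apply: single3|].
  case: (@nxt_runs [::] k p isT); rewrite !cats0 => h; [left|right].
    by apply: single3.
  by exists 1 => //; apply: letter_ext => //; case: h.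
case: p => [|y p]; first by case: (letterP x) => ->; [left; exact: single3|right; exists 1 =>
    //; apply: letter_ext|left; apply: single3].
left; apply: single3 => a b; case: (letterP x) => ->; case: (letterP y) => -> //=; by case: p.
Qed.

Lemma head_rev_letter (v : seq letter) : head l1 (rev v) = last l1 v.
Proof. by case/lastP: v => // v a; rewrite rev_rcons last_rcons. Qed.

Lemma last_nseq_letter (a : letter) k : last a (nseq k a) = a.
Proof. by elim: k. Qed.

(** The separating suffixes, besides the empty one, are [l2] for beta, 3^k for delta and zeta, and
    [l3] for eta. *)
Lemma lmap_cases s t : valid_S3 s -> single (lmap (ucode s) t) \/
  exists2 i, i < size (Lam s) & lmap (ucode s) t = nth nopt (Lam s) i.
Proof.
have rk k b : rev (b :: nseq k l3) = nseq k l3 ++ [:: b].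
  by rewrite rev_cons rev_nseq cats1.
rewrite /lmap; case: (rev t) => [|x p] {t}.
  case: s => [||| [|k]|[|k]|] // _; right; exists 0 => //; apply: letter_ext => //.
  1-4: by rewrite /nxt head_rev_letter /ucode /= ?last_nseq_letter.
case: s => [||| k|k|] k0.
- by left; apply: single3 => a b; case: (letterP x) => ->; case: p.
- case: p => [|y p]; first by case: (letterP x) => ->; [left; exact: single3|right; exists 1 =>
    //; apply: letter_ext|left; apply: single3].
  left; apply: single3 => a b; case: (letterP x) => ->; case: (letterP y) => -> //=; by case: p.
- left; apply: single3 => a b; case: (letterP x) => ->; case: p => [|y [|z p]] //=;
   try case: (letterP y) => -> //=; by move=> [<-] [<-].
- have E2 : rev (ucode (Sdelta k) l2) = nseq k l3 ++ [:: l2] by rewrite /ucode /= rk.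
  have E3 : rev (ucode (Sdelta k) l3) = nseq k.+1 l3 ++ [:: l2] by rewrite /ucode /= (rk k.+1).
  case: (@nxt_runs [:: l2] k (x :: p) isT) => h; [left|right].
    by apply: single3 => //; rewrite E2 E3.
  by exists 1 => //; apply: letter_ext => //; rewrite ?E2 ?E3; case: h.
- have E1 : rev (ucode (Szeta k) l1) = nseq k l3 ++ [::] by rewrite /ucode /= rev_nseq cats0.
  have E3 : rev (ucode (Szeta k) l3) = nseq k.+1 l3 ++ [::] by rewrite /ucode /= (rev_nseq k.+1)
      cats0.
  case: (x =P l2) => [->|/eqP x2].
    left; apply: single3; rewrite ?E1 ?E3; case: k k0 {E1 E3} => // k _; 
    by rewrite /=.
  have E2 : nxt (x :: p) (rev (ucode (Szeta k) l2)) = None.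
    by rewrite /ucode /= (negPf x2).
  case: (@nxt_runs [::] k (x :: p) isT) => h; [left|right].
    by apply: single3; rewrite ?E2 ?E1 ?E3.
  by exists 1 => //; apply: letter_ext => //; rewrite ?E1 ?E2 ?E3; case: h.
case: p => [|y p]; first by case: (letterP x) => ->; [left; exact: single3|left; apply:
    single3|right; exists 1 => //; apply: letter_ext].
left; apply: single3 => a b; case: (letterP x) => ->; case: (letterP y) => -> //=; by case: p.
Qed.

Lemma nxt_nseq k j T : nxt (nseq k l3) (nseq (k + j) l3 ++ T) = Some (head l1 (nseq j l3 ++ T)).
Proof. by elim: k => //= k ->. Qed.

(** For necessity each listed map has to come from an actual word, so that dendricity of the image
    language applies to it. *)
Lemma rmap_realize s i : valid_S3 s -> i < size (Rho s) ->
  exists2 p, l1 \notin p & rmap (ucode s) p = nth nopt (Rho s) i.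
Proof.
move=> vs; case: i => [|[|i]]; last by case: (s).
  by move=> _; exists [::] => //; case: s vs => [||| [|k]|[|k]|] // _; apply: letter_ext.
case: s vs => [||| k|k|] //= k0 _.
- by exists [:: l2] => //; apply: letter_ext.
- have nk j := nxt_nseq k j [::]; exists (l2 :: nseq k l3); first by rewrite inE mem_nseq andbF.
  by apply: letter_ext => //=; rewrite /rmap /ucode /=; [move: (nk 0)|move: (nk 1)]; rewrite
      cats0 ?addn0 ?addn1.
- have nk j := nxt_nseq k j [::]; exists (nseq k l3); first by rewrite mem_nseq andbF.
  apply: letter_ext => //=; rewrite /rmap /ucode /=; [move: (nk 0)| |move: (nk 1)]; rewrite
      ?cats0 ?addn0 ?addn1 //.
  by case: k k0 {nk}.
- by exists [:: l2] => //; apply: letter_ext.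
Qed.

Lemma lmap_realize s i : valid_S3 s -> i < size (Lam s) ->
  exists2 t, l1 \notin t & lmap (ucode s) t = nth nopt (Lam s) i.
Proof.
have rk k b : rev (b :: nseq k l3) = nseq k l3 ++ [:: b].
  by rewrite rev_cons rev_nseq cats1.
move=> vs; case: i => [|[|i]]; last by case: (s).
  move=> _; exists [::] => //; case: s vs => [||| [|k]|[|k]|] // _; apply: letter_ext => //.
  1-4: have -> s c : lmap (ucode s) [::] c = Some (last l1 (ucode s c)) by rewrite -head_rev_letter.
  1-4: by rewrite /ucode /= ?last_nseq_letter.
case: s vs => [||| k|k|] //= k0 _.
- by exists [:: l2] => //; apply: letter_ext.
- have nk j := nxt_nseq k j [:: l2]; exists (nseq k l3); first by rewrite mem_nseq andbF.
  apply: letter_ext => //=; rewrite /lmap /ucode /= ?rev_nseq ?rk ?(rk k.+1).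
  + by case: k k0 {nk}.
  + by move: (nk 0); rewrite addn0.
  + by move: (nk 1); rewrite addn1.
- have nk j := nxt_nseq k j [::]; exists (nseq k l3); first by rewrite mem_nseq andbF.
  apply: letter_ext => //=; rewrite /lmap /ucode /= ?rev_nseq ?(rev_nseq k.+1); [move: (nk 0)|
      |move: (nk 1)]; rewrite ?cats0 ?addn0 ?addn1 //.
  by case: k k0 {nk}.
- by exists [:: l3] => //; apply: letter_ext.
Qed.

Lemma imgmP f g (e : mat) a b : reflect (exists a' b', [/\ f a' = Some a, g b' = Some b & e a'
    b']) (imgm f g e a b).
Proof.
apply: (iffP (exlP _)) => [[a']|[a' [b' [fa gb eab]]]].
  by case: eqP => // fa /exlP[b']; case: eqP => // gb eab; exists a', b'.
by exists a'; rewrite fa eqxx; apply/exlP; exists b'; rewrite gb eqxx.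
Qed.

Lemma single_imgm_good f g e v : single f \/ single g -> nonempty (imgm f g e) ->
  good (imgm f g e) v.
Proof.
move=> sfg ne; apply: star_good => //.
case/exlP: ne => a0 /exlP[b0 /imgmP[a1 [b1 [fa gb _]]]].
case: sfg => sg; [left; exists a0|right; exists b0] => ? ? /imgmP[a2 [b2 [fa2 gb2 _]]].
  exact: sg fa2 fa.
exact: sg gb2 gb.
Qed.

(** * Words of the image language without l1 *)

Definition perfect (e : mat) : bool :=
  [&& treeb e, alll (fun a => ~~ lbad e a) & alll (fun a => ~~ rbad e a)].

Lemma perfect_good e v : perfect e -> good e v.
Proof.
case/and3P=> te /alllP hl /alllP hr; apply/and3P; split=> //.
  by apply/alllP => a; rewrite (negPf (hl a)).
by apply/alllP => a; rewrite (negPf (hr a)).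
Qed.

(* [freem s w] is the extension graph of a word [w] without [l1]. *)
Definition freem (s : S3) (w : seq letter) : mat :=
  fun a b => exl (fun c => infix (a :: rcons w b) (rcons (S3_morph s c) l1)).

Definition runw (j : nat) : seq letter := rcons (nseq j l3) l1.

Lemma prefix_runw w b j : prefix (rcons w b) (runw j) =
  (w == nseq (size w) l3) && ((b == l1) && (size w == j) || (b == l3) && (size w < j)).
Proof.
elim: j w => [|j IH] [|x w] /=; rewrite ?prefixs0 ?prefix0s ?andbT ?andbF ?orbF //.
- by case: w => [|y w]; rewrite /= ?andbF.
- by rewrite IH eqseq_cons eqSS ltnS andbA.
Qed.

Lemma infix_runw a w b j : infix (a :: rcons w b) (runw j) =
  [&& a == l3, w == nseq (size w) l3 & (b == l1) && (size w < j) || (b == l3) && ((size w).+1 < j)].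
Proof.
elim: j => [|j IH]; first by rewrite /= !andbF; case: w => [|x w]; rewrite /= ?andbF //.
have -> : infix (a :: rcons w b) (runw j.+1) =
   ((a == l3) && prefix (rcons w b) (runw j)) || infix (a :: rcons w b) (runw j) by [].
rewrite IH prefix_runw; case: (a == l3) => //=; case: (_ == nseq _ _) => //=.
rewrite !ltnS [size w <= j]leq_eqVlt [size w < j]leq_eqVlt.
by case: (b == l1); case: (b == l3); case: (size w == j) => /=; rewrite ?orbT ?orbF ?orbb ?andbT //;
  case: ltngtP.
Qed.

(** The booleans are the edges (h, l1), (h, l3), (l3, l1), (l3, l3) in the graph of a run of i
    letters [l3]; the three patterns are those of i < k, i = k and i = k + 1. *)
Lemma runs_good h (x y z t : bool) : h != l3 ->
  (x, y, z, t) \in [:: (false, true, true, true); (true, true, true, false); (true, false,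
      false, false)] ->
  perfect (fun a b => (a == h) && ((b == l1) && x || (b == l3) && y) ||
                      (a == l3) && ((b == l1) && z || (b == l3) && t)).
Proof.
by case: (letterP h) => -> // _; rewrite !inE => /or3P[] /eqP[-> -> -> ->]; vm_compute.
Qed.

Lemma exlE (P : pred letter) : exl P = [|| P l1, P l2 | P l3].
Proof. by rewrite /exl; case: (P l1); case: (P l2). Qed.

Lemma freem_delta k w a b : freem (Sdelta k) w a b =
  [|| infix (a :: rcons w b) [:: l1; l1], infix (a :: rcons w b) [:: l1, l2 & runw k] |
      infix (a :: rcons w b) [:: l1, l2 & runw k.+1]].
Proof. by rewrite /freem exlE. Qed.

Lemma freem_zeta k w a b : freem (Szeta k) w a b =
  [|| infix (a :: rcons w b) (l1 :: runw k), infix (a :: rcons w b) [:: l1; l2; l1] |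
      infix (a :: rcons w b) (l1 :: runw k.+1)].
Proof. by rewrite /freem exlE. Qed.

Lemma infix_cons_rcons (a b x : letter) w v : infix (a :: rcons w b) (x :: v) =
  (a == x) && prefix (rcons w b) v || infix (a :: rcons w b) v.
Proof. by []. Qed.

Lemma prefix1 (b x : letter) v : prefix (rcons [::] b) (x :: v) = (b == x).
Proof. by rewrite /= prefix0s andbT. Qed.

Lemma freem_nil s : valid_S3 s -> freem s [::] = base s.
Proof.
move=> vs; apply/funext => a; apply/funext => b.
case: s vs => [||| [|k]|[|k]|] //= _.
1-3, 6: by case: (letterP a) => ->; case: (letterP b) => ->; vm_compute.
- rewrite freem_delta !infix_cons_rcons !infix_runw !prefix1 !prefix_runw.
  by case: (letterP a) => ->; case: (letterP b) => ->; rewrite /= ?orbT //; case: k.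
- rewrite freem_zeta !infix_cons_rcons !infix_runw !prefix1 !prefix_runw.
  by case: (letterP a) => ->; case: (letterP b) => ->; rewrite /= ?orbT //; case: k.
Qed.

Lemma runs_entries a b h i k :
  (a == h) && ((b == l1) && (i == k) || (b == l3) && (i < k)) ||
    [&& a == l3 & (b == l1) && (i < k) || (b == l3) && (i.+1 < k)] ||
  ((a == h) && ((b == l1) && (i == k.+1) || (b == l3) && (i < k.+1)) ||
    [&& a == l3 & (b == l1) && (i < k.+1) || (b == l3) && (i.+1 < k.+1)]) =
  (a == h) && ((b == l1) && ((i == k) || (i == k.+1)) || (b == l3) && (i < k.+1)) ||
  (a == l3) && ((b == l1) && (i < k.+1) || (b == l3) && (i < k)).
Proof.
have h1 : (i < k) || (i < k.+1) = (i < k.+1) by apply/orb_idl/ltnW.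
have h2 : (i.+1 < k) || (i < k) = (i < k) by apply/orb_idl/ltnW.
rewrite [i.+1 < k.+1]ltnS; move: h1 h2.
by case: (a == h); case: (a == l3); case: (b == l1); case: (b == l3);
  case: (i == k); case: (i == k.+1); case: (i < k); case: (i < k.+1); case: (i.+1 < k).
Qed.

Lemma runs_perfect h i k : h != l3 -> let e := fun a b =>
  (a == h) && ((b == l1) && ((i == k) || (i == k.+1)) || (b == l3) && (i < k.+1)) ||
  (a == l3) && ((b == l1) && (i < k.+1) || (b == l3) && (i < k)) in
  nonempty e -> perfect e.
Proof.
move=> h3 /= ne; apply: runs_good => //.
case: (ltngtP i k) ne => [ik|ki|->] ne.
- by rewrite ltnS ltnW // (ltn_eqF (ltnW _)).
- rewrite ltnS leqNgt ki; case: (i =P k.+1) ne => // _ /exlP[a /exlP[b]].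
  by rewrite ltnS leqNgt ki !andbF.
- by rewrite ltnSn (ltn_eqF (ltnSn k)).
Qed.

Lemma freem_good s (w : seq letter) v : valid_S3 s -> l1 \notin w -> w != [::] ->
  nonempty (freem s w) -> good (freem s w) v.
Proof.
case: w => // x w vs nxw _ ne.
(* Outside delta and zeta an image has at most three letters, so [x :: w] has at most two and
   finitely many words remain. *)
have short : match s with Sdelta _ | Szeta _ => false | _ => true end -> good (freem s (x :: w)) v.
  move=> hs; have h3 c : size (S3_morph s c) <= 3 by case: (s) hs => //; case: (letterP c) => ->.
  have : size w <= 1.
    case/exlP: ne => a /exlP[b /exlP[c /size_infix]].
    by rewrite /= !size_rcons ltnS => /leq_trans /(_ (h3 c)).
  case: w nxw ne => [|y [|z w]] // nxw ne _; apply: perfect_good; move: nxw ne.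
    by case: s vs hs {h3} => [||| k|k|] // _ _; case: (letterP x) => ->; vm_compute.
  by case: s vs hs {h3} => [||| k|k|] // _ _; case: (letterP x) => ->; case: (letterP y) => ->;
      vm_compute.
have E11 a b : infix (a :: rcons (x :: w) b) [:: l1; l1] = false.
  by apply/negbTE/negP => /size_infix; rewrite /= size_rcons.
case: s vs ne short => [||| k|k|] vs ne short.
1-3, 6: exact: short.
- case: (letterP x) nxw E11 ne {short} => -> // nxw E11 ne.
    (* In the images of delta [l2] is always preceded by [l1], so a word beginning with [l2] has a
       star as its graph; a word beginning with [l3] must be a run of [l3]. *)
    apply: star_good => //; left; exists l1 => a b.
    rewrite freem_delta E11 !infix_cons_rcons !infix_runw !prefix_runw /=.
    by rewrite !andbF /= !orbF => /orP[] /andP[/eqP].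
  have pre32 r b : prefix (rcons (l3 :: w) b) (l2 :: r) = false by [].
  move: ne; have -> : freem (Sdelta k) (l3 :: w) = fun a b =>
     (l3 :: w == nseq (size (l3 :: w)) l3) && (
  (a == l2) && ((b == l1) && ((size (l3 :: w) == k) || (size (l3 :: w) == k.+1)) || (b == l3) &&
      (size (l3 :: w) < k.+1)) ||
  (a == l3) && ((b == l1) && (size (l3 :: w) < k.+1) || (b == l3) && (size (l3 :: w) < k))).
    apply/funext => a; apply/funext => b.
    rewrite freem_delta E11 !(infix_cons_rcons _ _ l1) !(infix_cons_rcons _ _ l2).
    rewrite !infix_runw !prefix_runw -runs_entries !pre32.
    by case: (l3 :: w == _); rewrite ?andbF ?andTb ?orFb.
  by case: (l3 :: w == _) => ne; [apply/perfect_good/runs_perfect|case/exlP: ne => ? /exlP[]].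
case: (letterP x) nxw ne {short E11} => -> // nxw ne.
  apply: star_good => //; left; exists l1 => a b.
  rewrite freem_zeta !(infix_cons_rcons _ _ l1) !(infix_cons_rcons _ _ l2).
  by rewrite !infix_runw !prefix_runw /= ?andbF /= ?orbF; case: eqP.
move: ne; have -> : freem (Szeta k) (l3 :: w) = fun a b =>
     (l3 :: w == nseq (size (l3 :: w)) l3) && (
  (a == l1) && ((b == l1) && ((size (l3 :: w) == k) || (size (l3 :: w) == k.+1)) || (b == l3) &&
      (size (l3 :: w) < k.+1)) ||
  (a == l3) && ((b == l1) && (size (l3 :: w) < k.+1) || (b == l3) && (size (l3 :: w) < k))).
  apply/funext => a; apply/funext => b; rewrite freem_zeta.
  have -> : infix (a :: rcons (l3 :: w) b) [:: l1; l2; l1] = false.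
    by rewrite /= !andbF; case: (w).
  rewrite orFb !(infix_cons_rcons _ _ l1) !infix_runw !prefix_runw -runs_entries.
  by case: (l3 :: w == _); rewrite ?andbF ?andTb ?orFb.
by case: (l3 :: w == _) => ne; [apply/perfect_good/runs_perfect|case/exlP: ne => ? /exlP[]].
Qed.

(** * Extension graphs of the image language *)

Section ImageStep.
Variables (s : S3) (L : language).
Hypotheses (vs : valid_S3 s) (eL : extendable L).
Local Notation M := (imL (S3_morph s) L).

Lemma S3_image_extendable : extendable M.
Proof.
rewrite S3_morphE; apply: imL_extendable => // a.
exists [:: a]; first exact: ext_letter.
rewrite -S3_morphE /apply_morph /= cats0.
by rewrite infix1s; case: s vs => [||| k|k|]; case: (letterP a) => -> //=; rewrite !inE ?orbT.
Qed.

Lemma S3_image_ematP w : M w ->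
  (l1 \notin w /\ emat M w = freem s w) \/
  exists x f g, [/\ L x, size x < size w, emat M w = imgm f g (emat L x) &
    [\/ single f, single g | (exists2 i, i < size (Lam s) & f = nth nopt (Lam s) i) /\
                             (exists2 i, i < size (Rho s) & g = nth nopt (Rho s) i)]].
Proof.
rewrite S3_morphE => Mw; case: (boolP (l1 \in w)) => [w1|nw]; last first.
  left; split=> //; apply/funext => a; apply/funext => b.
  by rewrite (imL_emat_free (@ucode_l1 s) eL) // /freem S3_morphE.
right; have [t [x [p [Ew nt np Lx]]]] := imL_cut (@ucode_l1 s) eL Mw w1.
exists x, (lmap (ucode s) t), (rmap (ucode s) p); split=> //.
(* The [l1] after the image of [x] makes [x] strictly shorter than [w], which is what the induction
   on length uses. *)
- by rewrite Ew !size_cat /= addnA addnS ltnS (leq_trans (F_size (ucode s) x)) // addnAC leq_addl.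
- by rewrite Ew (imL_emat_cut (@ucode_l1 s) (@ucode_inj s) eL).
case: (lmap_cases t vs) => [?|hf]; first by constructor 1.
by case: (rmap_cases p vs) => [?|hg]; [constructor 2|constructor 3].
Qed.

Lemma S3_image_good w v v' : img s v' = Some v -> M w ->
  (forall x, L x -> size x < size w -> good (emat L x) v') -> good (emat M w) v.
Proof.
move=> iv Mw IH; have ne := emat_nonempty S3_image_extendable Mw.
case: (S3_image_ematP Mw) => [[nw Ew]|[x [f [g [Lx sx Ew fg]]]]]; rewrite Ew in ne *.
  case: (w =P [::]) => [->|/eqP w0]; last exact: freem_good.
  by rewrite freem_nil //; apply: base_good iv.
case: fg => [sf|sg|[[i li Ei] [j lj Ej]]].
- by apply: single_imgm_good => //; left.
- by apply: single_imgm_good => //; right.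
have /(all_nthP nopt)/(_ i li)/(all_nthP nopt)/(_ j lj) := good_allimg (IH x Lx sx) iv.
by rewrite /= tabE -Ei -Ej; case: ifP => // /negP[]; exact: ne.
Qed.

Lemma S3_image_nth x i j : i < size (Lam s) -> j < size (Rho s) ->
  exists w, emat M w = imgm (nth nopt (Lam s) i) (nth nopt (Rho s) j) (emat L x).
Proof.
move=> li lj; have [t nt <-] := lmap_realize vs li; have [p np <-] := rmap_realize vs lj.
exists (t ++ apply_morph (return_code (ucode s)) x ++ l1 :: p).
by rewrite S3_morphE (imL_emat_cut (@ucode_l1 s) (@ucode_inj s) eL).
Qed.

Lemma S3_image_dendric_inv : dendric_lang M -> forall x, L x ->
  [/\ treeb (emat L x), forall a, lbad (emat L x) a -> img_def s (Some a, None) &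
      forall b, rbad (emat L x) b -> img_def s (None, Some b)].
Proof.
move=> dM x Lx; apply: allimg_treeb; first exact: emat_nonempty.
apply/(all_nthP nopt) => i li; apply/(all_nthP nopt) => j lj.
have [w Ew] := S3_image_nth x li lj.
rewrite /= tabE -Ew; case: ifP => // ne; apply: dM; exact: nonempty_emat S3_image_extendable _ ne.
Qed.

Lemma anyimgP (P : mat -> bool) x : anyimg s P (emat L x) -> (forall e, P e -> nonempty e) ->
  exists2 w, M w & P (emat M w).
Proof.
move=> h ne; move: h => /(has_nthP nopt)[i li /(has_nthP nopt)[j lj]].
rewrite tabE; have [w <-] := S3_image_nth x li lj => Pw.
by exists w => //; apply: (nonempty_emat S3_image_extendable); apply: ne.
Qed.

End ImageStep.

(** * Letters whose removal disconnects an extension graph *)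

Definition bad_left (L : language) (a : letter) : Prop := exists2 x, L x & lbad (emat L x) a.
Definition bad_right (L : language) (b : letter) : Prop := exists2 x, L x & rbad (emat L x) b.
Definition bad_type (L : language) (v : vtx) : Prop :=
  (forall a, bad_left L a <-> v.1 = Some a) /\ (forall b, bad_right L b <-> v.2 = Some b).

Lemma lbad_nonempty e a : lbad e a -> nonempty e.
Proof.
suff: if lbad e a then nonempty e else true by move=> /[swap] ->.
case: (letterP a) => ->; move: (e); apply: allmatP; by vm_cast_no_check (erefl true).
Qed.

Lemma nonempty_mtr e : nonempty (mtr e) = nonempty e.
Proof.
by apply/exlP/exlP => -[a /exlP[b eab]]; exists b; apply/exlP; exists a.
Qed.

Lemma treeb_mtr e : treeb (mtr e) = treeb e.
Proof.
apply/eqP; suff: treeb (tab (mtr e)) == treeb e by rewrite tabE.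
by move: (e); apply: allmatP; vm_cast_no_check (erefl true).
Qed.

Lemma rbad_nonempty e b : rbad e b -> nonempty e.
Proof. by move/lbad_nonempty; rewrite nonempty_mtr. Qed.

Lemma lcp_cases (T : eqType) (x y : seq T) : [\/ prefix x y, prefix y x |
  exists u d e r r', [/\ d != e, x = u ++ d :: r & y = u ++ e :: r']].
Proof.
elim: x y => [|a x IH] y; first by constructor 1; rewrite prefix0s.
case: y => [|b y]; first by constructor 2.
rewrite /=; case: eqP => [->|/eqP ne]; last by constructor 3; exists [::], a, b, x, y.
rewrite eqxx; case: (IH y) => [|| [u [d [e [r [r' [de -> ->]]]]]]]; [by constructor 1|by
    constructor 2|].
by constructor 3; exists (b :: u), d, e, r, r'.
Qed.

(** Both [x] and [y] have three left extensions. If [x] is a proper prefix of [y], the letter that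
    follows it there is adjacent to all left letters in the graph of [x], against [lbad_full]. If
    they diverge after [u], two right letters are adjacent to all left letters in the graph of [u],
    which gives a 4-cycle. So the words coincide and [lbad_uniq] concludes. *)
Lemma bad_left_uniq L a a' : extendable L -> dendric_lang L ->
  bad_left L a -> bad_left L a' -> a = a'.
Proof.
move=> eL dL [x Lx bx] [y Ly byy].
have chain p q b b' : L p -> L q -> lbad (emat L p) b -> lbad (emat L q) b' -> prefix p q -> p = q.
  move=> Lp Lq bp bq /prefixP[[|d r] Eq]; first by rewrite Eq cats0.
  have [_ /(_ d)/negP[]] := lbad_full (dL _ Lp) bp.
  have [/alllP fq _] := lbad_full (dL _ Lq) bq.
  apply/alllP => c; apply/asboolP; apply: (lang_catl eL (v := r)).
  by move: (fq c); rewrite emat_presentl // Eq => /asboolP; rewrite /= cat_rcons.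
have [fx _] := lbad_full (dL _ Lx) bx; have [fy _] := lbad_full (dL _ Ly) byy.
case: (lcp_cases x y) => [pxy|pyx|[u [d [e [r [r' [de Ex Ey]]]]]]].
- have E := chain _ _ _ _ Lx Ly bx byy pxy; rewrite E in bx.
  exact: lbad_uniq (dL _ Ly) bx byy.
- have E := chain _ _ _ _ Ly Lx byy bx pyx; rewrite E in byy.
  exact: lbad_uniq (dL _ Lx) bx byy.
have ud c : emat L u c d.
  apply/asboolP; apply: (lang_catl eL (v := r)).
  by move/alllP/(_ c): fx; rewrite emat_presentl // Ex => /asboolP; rewrite /= cat_rcons.
have ue c : emat L u c e.
  apply/asboolP; apply: (lang_catl eL (v := r')).
  by move/alllP/(_ c): fy; rewrite emat_presentl // Ey => /asboolP; rewrite /= cat_rcons.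
have Lu : L u by apply: (lang_catl eL (v := d :: r)); rewrite -Ex.
have [//|/eqP] := treeb_4cycle (dL u Lu) (ud l1) (ue l1) (ud l2) (ue l2).
by rewrite (negPf de).
Qed.

(** Reversal transfers to the right the uniqueness proved on the left. *)
Definition revL (L : language) : language := fun w => L (rev w).

Lemma revL_extendable L : extendable L -> extendable (revL L).
Proof.
move=> eL; split=> [u w v|w /(ext_both eL)[a [b Lab]]|a]; rewrite /revL.
- by rewrite !rev_cat -catA; apply: ext_fact.
- by exists b, a; rewrite rev_cons rev_rcons.
exact: ext_letter.
Qed.

Lemma emat_revL L w : emat (revL L) w = mtr (emat L (rev w)).
Proof.
apply/funext => a; apply/funext => b.
by rewrite /mtr /emat /revL rev_cons rev_rcons.
Qed.

Lemma revL_dendric L : dendric_lang L -> dendric_lang (revL L).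
Proof. by move=> dL w Lw; rewrite emat_revL treeb_mtr; apply: dL. Qed.

Lemma bad_left_revL L a : bad_left (revL L) a <-> bad_right L a.
Proof.
split=> -[x Lx bx]; exists (rev x); rewrite ?emat_revL ?revK // /revL ?revK //.
by rewrite emat_revL in bx.
Qed.

Lemma bad_right_uniq L a a' : extendable L -> dendric_lang L ->
  bad_right L a -> bad_right L a' -> a = a'.
Proof.
move=> eL dL ba ba'.
by apply: (bad_left_uniq (revL_extendable eL) (revL_dendric dL)); apply/bad_left_revL.
Qed.

Lemma bad_type_exists L : extendable L -> dendric_lang L -> exists v, bad_type L v.
Proof.
move=> eL dL.
have H (P : letter -> Prop) : (forall a a', P a -> P a' -> a = a') ->
    exists o : option letter, forall a, P a <-> o = Some a.
  move=> uP; case: (pselect (exists a, P a)) => [[a Pa]|nP].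
    by exists (Some a) => b; split=> [Pb|[<-]] //; rewrite (uP _ _ Pa Pb).
  by exists None => b; split=> // Pb; case: nP; exists b.
have [l hl] := H _ (fun a a' => @bad_left_uniq L a a' eL dL).
have [r hr] := H _ (fun a a' => @bad_right_uniq L a a' eL dL).
by exists (l, r).
Qed.

Lemma bad_type_good L v : dendric_lang L -> bad_type L v -> forall x, L x -> good (emat L x) v.
Proof.
move=> dL [hl hr] x Lx; apply/and3P; split; first exact: dL.
  by apply/alllP => a; apply/implyP => ba; apply/eqP/hl; exists x.
by apply/alllP => a; apply/implyP => ba; apply/eqP/hr; exists x.
Qed.

Lemma bad_type_img s L v' v : valid_S3 s -> extendable L ->
  dendric_lang (imL (S3_morph s) L) -> bad_type L v' -> bad_type (imL (S3_morph s) L) v ->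
  img s v' = Some v.
Proof.
move=> vs eL dM bL bM.
have eM := S3_image_extendable vs eL.
have inv := S3_image_dendric_inv vs eL dM.
have dL : dendric_lang L by move=> x /inv[].
have [l r] : img_def s (v'.1, None) /\ img_def s (None, v'.2).
  case: v' bL => [l r] [/= hl hr]; split.
    case: l hl => [a|] hl; last by case: (s).
    by have [x /inv[_ h _] /h] := (hl a).2 erefl.
  case: r hr => [a|] hr; last by case: (s).
  by have [x /inv[_ _ h] /h] := (hr a).2 erefl.
have := img_def_split l r; rewrite -surjective_pairing /img_def {l r}.
(* [S3_image_good] bounds the bad letters of the image by [v0], and [img_lbad] and [img_rbad] show
   that the letters of [v0] are bad; hence [v0] is the exact type. *)
case E: (img s v') => [v0|] // _; congr Some.
have gd w : imL (S3_morph s) L w -> good (emat (imL (S3_morph s) L) w) v0.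
  by move=> Mw; apply: (S3_image_good vs eL E Mw) => x Lx _; apply: bad_type_good bL x Lx.
have base_img : emat (imL (S3_morph s) L) [::] = base s.
  case: (S3_image_ematP vs eL (lang_nil eM)) => [[_ ->]|[x [f [g [_]]]]]; last by [].
  exact: freem_nil.
have badl a : v0.1 = Some a -> bad_left (imL (S3_morph s) L) a.
  case: v0 E gd => l r E _ /= El; case: (img_lbad E El) => [ba|[Ea ha]].
    by exists [::]; [exact: lang_nil|rewrite base_img].
  have [x Lx /ha h] := (bL.1 a).2 Ea.
  have [w Mw bw] := anyimgP vs eL h (fun e => @lbad_nonempty e a); by exists w.
have badr a : v0.2 = Some a -> bad_right (imL (S3_morph s) L) a.
  case: v0 E gd {badl} => l r E _ /= El; case: (img_rbad E El) => [ba|[Ea ha]].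
    by exists [::]; [exact: lang_nil|rewrite base_img].
  have [x Lx /ha h] := (bL.2 a).2 Ea.
  have [w Mw bw] := anyimgP vs eL h (fun e => @rbad_nonempty e a); by exists w.
have option_eq (o o' : option letter) : (forall a, o = Some a <-> o' = Some a) -> o = o'.
  by case: o => [a|] h; [rewrite (h a).1|case: o' h => // a /(_ a)[_ ->]].
case: v bM v0 E gd badl badr => [l r] [/= hl hr] [l0 r0] E gd /= badl badr; congr pair.
  apply: option_eq => a; split=> [/badl/hl//|/hl[w Mw bw]].
  by have /and3P[_ /alllP/(_ a)/implyP/(_ bw)/eqP] := gd _ Mw.
apply: option_eq => a; split=> [/badr/hr//|/hr[w Mw bw]].
by have /and3P[_ _ /alllP/(_ a)/implyP/(_ bw)/eqP] := gd _ Mw.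
Qed.

(** * Renaming letters *)

Definition pmL (p : {perm letter}) (L : language) : language := fun w => L (map (p^-1)%g w).

Lemma perm_map_inv (p : {perm letter}) w : map p (map (p^-1)%g w) = w.
Proof. by rewrite mapK //; exact: permKV. Qed.

Lemma inv_map_perm (p : {perm letter}) w : map (p^-1)%g (map p w) = w.
Proof. by rewrite mapK //; exact: permK. Qed.

Lemma pmLK p L : pmL p (pmL (p^-1)%g L) = L.
Proof. by apply/funext => w; rewrite /pmL invgK perm_map_inv. Qed.

Lemma pmLKV p L : pmL (p^-1)%g (pmL p L) = L.
Proof. by apply/funext => w; rewrite /pmL invgK inv_map_perm. Qed.

Lemma infix_map (T S : eqType) (f : T -> S) v w : infix v w -> infix (map f v) (map f w).
Proof. by case/infixP=> x [y ->]; rewrite !map_cat infix_catl // infix_catr // infix_refl. Qed.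

Section Renaming.
Variables (p : {perm letter}) (L : language).

Lemma pmL_extendable : extendable L -> extendable (pmL p L).
Proof.
move=> eL; split=> [u w v|w /(ext_both eL)[a [b Lab]]|a]; rewrite /pmL.
- by rewrite !map_cat; apply: ext_fact.
- by exists (p a), (p b); rewrite /= map_rcons !permK.
exact: (ext_letter eL).
Qed.

Lemma pmL_recurrent : recurrent L -> recurrent (pmL p L).
Proof.
move=> rL w /rL[N hN]; exists N => v Lv sv.
by have /(infix_map p) := hN _ Lv (leq_trans sv (eq_leq (esym (size_map _ _)))); rewrite
    !perm_map_inv.
Qed.

Lemma emat_pmL w : emat (pmL p L) w = pmat (p^-1)%g (emat L (map (p^-1)%g w)).
Proof. by apply/funext => a; apply/funext => b; rewrite /pmat /emat /pmL /= map_rcons. Qed.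

Lemma exl_perm (P : pred letter) : exl (fun a => P (p a)) = exl P.
Proof.
apply/exlP/exlP => [[a Pa]|[a Pa]]; first by exists (p a).
by exists ((p^-1)%g a); rewrite permKV.
Qed.

Lemma alll_perm (P : pred letter) : alll (fun a => P (p a)) = alll P.
Proof.
apply/alllP/alllP => h a; last exact: h.
by rewrite -(permKV p a).
Qed.

Lemma suml_perm (f : letter -> nat) : suml (fun a => f (p a)) = suml f.
Proof.
have sumlE g : suml g = \sum_a g a.
  rewrite /suml !big_ord_recl big_ord0 addn0 addnA.
  by congr (g _ + g _ + g _); apply: val_inj.
by rewrite !sumlE [RHS](reindex_inj (@perm_inj _ p)).
Qed.

Lemma present_pmat e a : present (pmat p e) a = present e (p a).
Proof. exact: (exl_perm (e (p a))). Qed.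

Lemma share_pmat e a b : share (pmat p e) a b = share e (p a) (p b).
Proof. exact: (exl_perm (fun d => if e (p a) d then e (p b) d else false)). Qed.

Lemma linked_pmat e a b : linked (pmat p e) a b = linked e (p a) (p b).
Proof.
rewrite /linked share_pmat; case: (share _ _ _) => //.
by rewrite -[RHS]exl_perm; congr exl; apply/funext => c; rewrite !share_pmat.
Qed.

Lemma treeb_pmat e : treeb (pmat p e) = treeb e.
Proof.
rewrite /treeb; congr (if ~~ _ then _ else if ~~ _ then _ else _ + _ == _ + _).
- rewrite /nonempty -(exl_perm (fun a => exl (e a))); congr exl; apply/funext => a.
  exact: (exl_perm (e (p a))).
- rewrite /connected -[RHS]alll_perm; congr alll; apply/funext => a; rewrite present_pmat.
  case: present => //; rewrite -[RHS]alll_perm; congr alll; apply/funext => b.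
  by rewrite present_pmat linked_pmat.
- rewrite -(suml_perm (fun a => suml (fun b => e a b))); congr suml; apply/funext => a.
  exact: (suml_perm (fun b => e (p a) b)).
- rewrite -(suml_perm (fun a => present e a)); congr suml; apply/funext => a.
  by rewrite present_pmat.
rewrite -(suml_perm (fun a => present (mtr e) a)); congr suml; apply/funext => a.
by congr nat_of_bool; exact: (exl_perm (fun c => e c (p a))).
Qed.

Lemma lbad_pmat e a : lbad (pmat p e) a = lbad e (p a).
Proof.
rewrite /lbad -[RHS]exl_perm; congr exl; apply/funext => b.
rewrite -[RHS]exl_perm; congr exl; apply/funext => c.
by rewrite !present_pmat share_pmat !(inj_eq (@perm_inj _ p)).
Qed.

Lemma rbad_pmat e b : rbad (pmat p e) b = rbad e (p b).
Proof. exact: (lbad_pmat (mtr e) b). Qed.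

End Renaming.

Lemma pmL_dendric p L : dendric_lang L -> dendric_lang (pmL p L).
Proof. by move=> dL w Lw; rewrite emat_pmL treeb_pmat; apply: dL. Qed.

Lemma good_pmat (p : {perm letter}) e v : good (pmat p e) v = good e (pact p v).
Proof.
have omapE (o : option letter) a : (omap p o == Some (p a)) = (o == Some a).
  by case: o => //= b; rewrite !(inj_eq (@Some_inj _)) (inj_eq (@perm_inj _ p)).
rewrite /good treeb_pmat; congr [&& _, _ & _].
  rewrite -[RHS](alll_perm p); congr alll; apply/funext => a.
  by rewrite lbad_pmat omapE.
rewrite -[RHS](alll_perm p); congr alll; apply/funext => a.
by rewrite rbad_pmat omapE.
Qed.

Lemma pactK (p : {perm letter}) : cancel (pact p) (pact (p^-1)%g).
Proof. by case=> -[a|] [b|]; rewrite /pact /= ?permK. Qed.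

Lemma pactKV (p : {perm letter}) : cancel (pact (p^-1)%g) (pact p).
Proof. by case=> -[a|] [b|]; rewrite /pact /= ?permKV. Qed.

Lemma good_pmL p L w v : good (emat (pmL p L) (map p w)) (pact p v) = good (emat L w) v.
Proof. by rewrite emat_pmL inv_map_perm good_pmat pactK. Qed.

Lemma bad_type_pmL p L v : bad_type L v -> bad_type (pmL p L) (pact p v).
Proof.
have H (o : option letter) a : omap p o = Some a <-> o = Some ((p^-1)%g a).
  by case: o => [b|] /=; split=> // -[]; [move<-; rewrite permK|move->; rewrite permKV].
have lE a : bad_left (pmL p L) a <-> bad_left L ((p^-1)%g a).
  split=> -[x Lx bx].
    by exists (map (p^-1)%g x) => //; rewrite emat_pmL lbad_pmat in bx.
  by exists (map p x); rewrite /pmL ?inv_map_perm // emat_pmL lbad_pmat inv_map_perm.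
have rE a : bad_right (pmL p L) a <-> bad_right L ((p^-1)%g a).
  split=> -[x Lx bx].
    by exists (map (p^-1)%g x) => //; rewrite emat_pmL rbad_pmat in bx.
  by exists (map p x); rewrite /pmL ?inv_map_perm // emat_pmL rbad_pmat inv_map_perm.
by case=> hl hr; split=> a; [rewrite lE hl H|rewrite rE hr H].
Qed.

Lemma imL_comp3 p s p' L : imL (comp3 p s p') L = pmL p (imL (S3_morph s) (pmL p' L)).
Proof.
have E v : apply_morph (comp3 p s p') v = map p (apply_morph (S3_morph s) (map p' v)).
  by elim: v => // a v IH; rewrite !apply_morph_cons IH map_cat.
apply/funext => w; apply/propext; split=> [[v Lv wv]|[v Lv wv]].
  exists (map p' v); rewrite /pmL ?inv_map_perm //.
  by move: wv; rewrite E => /(infix_map (p^-1)%g); rewrite inv_map_perm.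
exists (map (p'^-1)%g v) => //; rewrite E perm_map_inv.
by move: wv => /(infix_map p); rewrite perm_map_inv.
Qed.

(** The five vertices represent the orbits of pairs [l, r] under renaming: each entry is absent or
    present, and two present entries are equal or distinct. *)
Lemma G'_vertex_orbit v : exists p : {perm letter}, G'_vertex (pact (p^-1)%g v).
Proof.
suff [p hp] : exists p : {perm letter}, G'_vertex (pact p v) by exists (p^-1)%g; rewrite invgK.
have : has (fun k => let f := nth id perms3 k in G'_vertex (omap f v.1, omap f v.2)) (iota 0 6).
  case: v => l r; suff /alloptP/(_ l)/alloptP/(_ r) : allopt (fun l => allopt (fun r =>
    has (fun k => let f := nth id perms3 k in G'_vertex (omap f l, omap f r)) (iota 0 6))) by [].
  by vm_compute.
case/hasP=> k; rewrite mem_iota => /andP[_ /perms3_perm[p hp]] h; exists p.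
rewrite /pact; have -> : fun_of_perm p = nth id perms3 k by apply/funext.
exact: h.
Qed.

(** * Desubstitution of a dendric language *)

Section Runs.
Variable M : language.
Hypotheses (eM : extendable M) (rM : recurrent M) (dM : dendric_lang M).

Lemma ematT w a b : emat M w a b -> M (a :: rcons w b).
Proof. by move/asboolP. Qed.

(** Let k + 1 be the longest run. In the tree of 3^k the left vertices [h] and [l3] must be
    connected although the edge (l3, l3) is missing, which forces the edge (h, l1), that is, a run
    of exactly k. For 0 < j < k the edges (h, l3), (l3, l1), (l3, l3) are present in the graph of
    3^j, so (h, l1) would close a 4-cycle. *)
Lemma run_lengths h : M [:: l3; l3] ->
  (forall a, M [:: a; l3] -> a = h \/ a = l3) -> (forall b, M [:: l3; b] -> b = l1 \/ b = l3) ->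
  exists2 k, 0 < k & forall j, 0 < j -> M (h :: runw j) <-> j = k \/ j = k.+1.
Proof.
move=> M33 predM succM.
have bnd : exists N, forall j, `[< M (nseq j l3) >] -> j <= N.
  have [N hN] := long_l1 eM rM; exists N => j /asboolP Mj; rewrite leqNgt; apply/negP => Nj.
  by move: (hN _ Mj); rewrite size_nseq mem_nseq andbF => /(_ (ltnW Nj)).
have ex2 : exists j, `[< M (nseq j l3) >] by exists 2; apply/asboolP.
have [N hN] := bnd; have [m /asboolP Mm maxm] := ex_maxnP ex2 hN.
have m2 : 1 < m by apply: maxm; apply/asboolP.
have nlong j : m < j -> ~ M (nseq j l3).
  by move=> mj /asboolP/maxm; rewrite leqNgt mj.
have nseqD i j : nseq (i + j) l3 = nseq i l3 ++ nseq j l3 :> seq letter by rewrite nseqD.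
have rconsn j : rcons (nseq j l3) l3 = nseq j.+1 l3 by elim: j => //= j ->.
have sub j w : M (nseq j l3 ++ w) -> forall i, i <= j -> M (nseq i l3 ++ w).
  by move=> Mj i ij; move: Mj; rewrite -(subnK ij) nseqD -catA => /(lang_catr eM).
have [a [b Mab]] := ext_both eM Mm.
have predm a' w j : 0 < j -> M (a' :: nseq j l3 ++ w) -> a' = h \/ a' = l3.
  by case: j => // j _ Mj; apply: predM; apply: (lang_catl eM (v := nseq j l3 ++ w)).
have succm b' w j : 0 < j -> M (w ++ rcons (nseq j l3) b') -> b' = l1 \/ b' = l3.
  case: j => // j _ Mj; apply: succM; apply: (lang_catr eM (w := w ++ nseq j l3)).
  by move: Mj; rewrite -rconsn -!cats1 -!catA.
have Ea : a = h.
  case: (@predm a [:: b] m (ltnW m2)) => [|//|a3]; first by rewrite cats1.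
  case: (nlong m.+1) => //; apply: (lang_catl eM (v := [:: b])).
  by move: Mab; rewrite a3 -cats1.
have Eb : b = l1.
  case: (@succm b [:: a] m (ltnW m2)) => [|//|b3] //.
  case: (nlong m.+1) => //; apply: (lang_catr eM (w := [:: a])).
  by move: Mab; rewrite b3 /= rconsn.
rewrite {}Ea {}Eb in Mab.
have M31 j : j < m -> M (l3 :: runw j).
  move=> jm; have /sub/(_ j.+1 jm) : M (nseq m l3 ++ [:: l1]); last by rewrite cats1.
  by apply: (lang_catr eM (w := [:: h])); rewrite cats1.
have Mh3 j : j < m -> M (h :: rcons (nseq j l3) l3).
  move=> jm; rewrite rconsn; apply: (lang_catl eM (v := rcons (nseq (m - j.+1) l3) l1)).
  by rewrite cat_cons -rcons_cat -nseqD subnKC.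
case: m m2 Mm maxm nlong sub Mab M31 Mh3 => // k k1 Mm maxm nlong sub Mab M31 Mh3.
have h3 : h != l3.
  apply/eqP => h3; apply: (nlong k.+2 (ltnSn _)); apply: (lang_catl eM (v := [:: l1])).
  by move: Mab; rewrite h3 cats1.
exists k => // j j0; split=> [Mj|[->|->//]]; last first.
  pose e := emat M (nseq k l3).
  have te : treeb e by apply: dM; apply: (lang_catr eM (w := [:: l3])).
  have e3 c : e c l1 -> c = h \/ c = l3.
    by move/ematT; rewrite -cats1; apply: predm.
  have e33 : ~~ e l3 l3.
    by apply/negP => /ematT; rewrite rconsn; apply: (nlong k.+2).
  have e31 : e l3 l1 by apply/asboolP; apply: M31.
  have eh3 : e h l3 by apply/asboolP; apply: Mh3.
  have ec1 c : e c l3 -> c = h.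
    by move=> ec; case: (@predm c [:: l3] k) => [//||//|c3]; [rewrite cats1; apply:
        ematT|rewrite c3 in ec; rewrite ec in e33].
  have er b' c : e b' c -> c = l1 \/ c = l3 by move/ematT; apply: (@succm c [:: b'] k).
  suff: e h l1 by move/ematT.
  move: (te); rewrite treeb_acyclic => /and4P[_ /alllP/(_ h) + _ _].
  have -> : present e h by apply/exlP; exists l3.
  move/alllP/(_ l3); have -> : present e l3 by apply/exlP; exists l1.
  move=> lk; have : share e h l3.
    move: lk; rewrite /linked; case: ifP => // nsh /exlP[c]; case: ifP => // shc shc3.
    case/exlP: (shc) => d; case: ifP => // _ /ematT; rewrite -cats1 => /predm[//|c3|c3].
      by rewrite c3 nsh in shc3.
    by rewrite c3 nsh in shc.
  by case/exlP=> d; case: ifP => // ehd e3d; case: (er _ _ ehd) => E; [rewrite E in ehd|rewrite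
      E (negPf e33) in e3d].
have [jk|kj] := leqP j k.
  case: (ltngtP j k) jk => // [jk _|->]; last by left.
  have te : treeb (emat M (nseq j l3)) by apply: dM; apply: (lang_catr eM (w := [:: h])); apply:
      (lang_catl eM (v := [:: l1])); rewrite cats1.
  have M33j : M (l3 :: rcons (nseq j l3) l3).
    have := Mm; rewrite -[nseq k.+1 _]cats0 => /sub/(_ j.+2); rewrite cats0 rconsn; apply.
    by rewrite ltnS.
  have [||||hl3|] // := treeb_4cycle te (a := h) (a' := l3) (b := l1) (b' := l3); try exact/asboolP.
  - by apply/asboolP/Mh3; rewrite ltnS ltnW.
  - by apply/asboolP/M31; rewrite ltnS ltnW.
  by rewrite hl3 eqxx in h3.
right; apply/eqP; rewrite eqn_leq kj andbT leqNgt; apply/negP => kj2.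
apply: (nlong j kj2); apply: (lang_catr eM (w := [:: h])); apply: (lang_catl eM (v := [:: l1])).
by rewrite cats1.
Qed.
End Runs.

(** * Return words to l1 read from the two-letter words *)

Section Returns.
Variable M : language.
Hypotheses (eM : extendable M) (rM : recurrent M) (dM : dendric_lang M).
Variable s : S3.
Hypothesis baseM : emat M [::] = base s.

Lemma pairM a b : M [:: a; b] <-> base s a b.
Proof. by rewrite -baseM; split=> [?|/asboolP//]; apply/asboolP. Qed.

Lemma forcedr w a b : M (rcons w a) -> (forall c, base s a c -> c = b) ->
  M (rcons (rcons w a) b).
Proof.
move=> Mw fb; have [c Mc] := lang_extr eM Mw; rewrite -(fb c) //; apply/pairM.
by apply: (lang_catr eM (w := w)); move: Mc; rewrite -!cats1 -!catA.
Qed.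

Lemma forcedl w a b : M (a :: w) -> (forall c, base s c a -> c = b) -> M (b :: a :: w).
Proof.
move=> Mw fb; have [c Mc] := lang_extl eM Mw; rewrite -(fb c) //; apply/pairM.
exact: (lang_catl eM (v := w)).
Qed.

Lemma pathM a w : M (a :: w) -> path (base s) a w.
Proof.
elim: w a => [|b w IH] a //= Mw; rewrite IH ?andbT; last exact: (lang_catr eM (w := [:: a])).
by apply/pairM; apply: (lang_catl eM (v := w)).
Qed.

End Returns.

Ltac letters3 a := case: (letterP a) => ->.

Lemma path_runs s a w : (forall b, base s l3 b -> b = l1 \/ b = l3) -> l1 \notin w ->
  path (base s) l3 (rcons w a) -> w = nseq (size w) l3.
Proof.
move=> h3; elim: w => [|b w IH] //=; rewrite inE negb_or => /andP[b1 nw] /andP[/h3[E|->]].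
  by rewrite E eqxx in b1.
by move=> /(IH nw) <-.
Qed.

(** Return words are paths from [l1] to [l1] in the digraph [base s]. Outside delta and zeta there
    are finitely many, and each occurs because its steps are forced by letters with a unique
    successor or predecessor. For delta and zeta the loop at [l3] leaves the run length free;
    [run_lengths] fixes it, and [k0] is replaced by the true k. *)
Lemma return_words M s : extendable M -> recurrent M -> dendric_lang M ->
  emat M [::] = base s -> exists2 s', valid_S3 s' &
  forall q, l1 \notin q -> M (l1 :: rcons q l1) <-> exists c, q = ucode s' c.
Proof.
move=> eM rM dM; case: s => [||| k0|k0|] bM;
  have pM := pairM bM; have fr := forcedr eM bM; have fl := forcedl eM bM; have pa := pathM eM bM.
- exists Salpha => // q nq; split=> [/pa|[c ->]].
    case: q nq => [|x [|y q]] nq; first by exists l1.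
      by move: nq; letters3 x => // _ _; [exists l2|exists l3].
    by move: nq; letters3 x => //; letters3 y.
  letters3 c; first exact/pM.
    by apply: (fr [:: l1] l2 l1) => [|d]; [exact/pM|letters3 d].
  by apply: (fr [:: l1] l3 l1) => [|d]; [exact/pM|letters3 d].
- exists Sbeta => // q nq; split=> [/pa|[c ->]].
    case: q nq => [|x [|y [|z q]]] nq; first by exists l1.
    + by move: nq; letters3 x => //; exists l2.
    + by move: nq; letters3 x => //; letters3 y => //; exists l3.
    by move: nq; letters3 x => //; letters3 y => //; letters3 z.
  letters3 c; first exact/pM.
    by apply: (fr [:: l1] l2 l1) => [|d]; [exact/pM|letters3 d].
  apply: (fr [:: l1; l3] l2 l1) => [|d]; last by letters3 d.
  by apply: (fr [:: l1] l3 l2) => [|d]; [exact/pM|letters3 d].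
- exists Sgamma => // q nq; split=> [/pa|[c ->]].
    case: q nq => [|x [|y [|z q]]] nq; first by exists l1.
    + by move: nq; letters3 x => //; exists l2.
    + by move: nq; letters3 x => //; letters3 y => //; exists l3.
    by move: nq; letters3 x => //; letters3 y => //; letters3 z.
  letters3 c; first exact/pM.
    by apply: (fl [:: l1] l2 l1) => [|d]; [exact/pM|letters3 d].
  apply: (fr [:: l1; l2] l3 l1) => [|d]; last by letters3 d.
  by apply: (fl [:: l3] l2 l1) => [|d]; [exact/pM|letters3 d].
- have [|a /(pM _ _).1|b /(pM _ _).1|k k0' hk] := run_lengths eM rM dM (h := l2).
  + exact/pM.
  + by letters3 a => // _; [left|right].
  + by letters3 b => // _; [left|right].
  exists (Sdelta k) => // q nq; split=> [Mq|[c ->]].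
    have := pa _ _ Mq; case: q nq Mq => [|x [|y q]] nq Mq; first by exists l1.
      by move: nq; letters3 x.
    rewrite /=; move: nq Mq; letters3 x => //; letters3 y => // nq Mq /= /path_runs Eq.
    have {}Eq : q = nseq (size q) l3.
      by apply: Eq; [move=> b; letters3 b => // _; [left|right]|move: nq; rewrite !inE].
    have /hk[//|Ek|Ek] : M (l2 :: runw (size q).+1).
      by rewrite /runw /= -Eq; apply: (lang_catr eM (w := [:: l1])).
    + by exists l2; rewrite /ucode /= -Ek /= -Eq.
    + by case: Ek => Ek; exists l3; rewrite /ucode /= -Ek -Eq.
  letters3 c; first exact/pM.
    by apply: (fl (runw k) l2 l1) => [|d]; [apply/hk => //; left|letters3 d].
  by apply: (fl (runw k.+1) l2 l1) => [|d]; [apply/hk => //; right|letters3 d].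
- have [|a /(pM _ _).1|b /(pM _ _).1|k k0' hk] := run_lengths eM rM dM (h := l1).
  + exact/pM.
  + by letters3 a => // _; [left|right].
  + by letters3 b => // _; [left|right].
  exists (Szeta k) => // q nq; split=> [Mq|[c ->]].
    have := pa _ _ Mq; case: q nq Mq => [|x q] nq Mq //.
    rewrite /=; move: nq Mq; letters3 x => // nq Mq.
      by case: q nq Mq => [|y q] nq Mq; [exists l2|move: nq; letters3 y].
    move=> /path_runs Eq.
    have {}Eq : q = nseq (size q) l3.
      by apply: Eq; [move=> b; letters3 b => // _; [left|right]|move: nq; rewrite !inE].
    have /hk[//|Ek|Ek] : M (l1 :: runw (size q).+1) by rewrite /runw /= -Eq.
    + by exists l1; rewrite /ucode /= -Ek /= -Eq.
    + by case: Ek => Ek; exists l3; rewrite /ucode /= -Ek -Eq.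
  letters3 c; [|by apply: (fr [:: l1] l2 l1) => [|d]; [exact/pM|letters3 d]|].
    by apply/(hk k) => //; left.
  by apply/(hk k.+1) => //; right.
exists Seta => // q nq; split=> [/pa|[c ->]].
  case: q nq => [|x [|y [|z q]]] nq //.
  + by move: nq; letters3 x => // _ _; [exists l2|exists l1].
  + by move: nq; letters3 x => //; letters3 y => //; exists l3.
  by move: nq; letters3 x => //; letters3 y => //; letters3 z.
letters3 c.
- by apply: (fr [:: l1] l3 l1) => [|d]; [exact/pM|letters3 d].
- by apply: (fl [:: l1] l2 l1) => [|d]; [exact/pM|letters3 d].
apply: (fr [:: l1; l2] l3 l1) => [|d]; last by letters3 d.
by apply: (fl [:: l3] l2 l1) => [|d]; [exact/pM|letters3 d].
Qed.

(** * Infinite desubstitution *)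

Definition good_lang (L : language) : Prop := [/\ extendable L, recurrent L & dendric_lang L].

(** By recurrence a long word starting with a letter of S contains a letter outside S; the first
    exit from S is the required edge. *)
Lemma strongly_emat L : extendable L -> recurrent L -> strongly (emat L [::]).
Proof.
move=> eL rL.
have allrowI (P : pred (letter -> bool)) : (forall f, P f) -> allrow P.
  by move=> h; rewrite /allrow /allbool !h.
apply: allrowI => S; apply/or3P.
case: (boolP (alll S)) => [_|/alllP nS]; first by constructor 1.
case: (boolP (exl S)) => [/exlP[a Sa]|_]; last by constructor 2.
constructor 3.
have [d Sd] : exists d, ~~ S d.
  by apply: contrapT => nd; apply: nS => d; apply: contrapT => /negP ?; apply: nd; exists d.
have [N hN] := rL _ (ext_letter eL d).
have [x [y [_ sy Lxy]]] := lang_extn eL N (ext_letter eL a).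
have {Lxy}La : L (a :: y) by move/(lang_catr eL): Lxy.
have dy : d \in a :: y by rewrite -infix1s hN //= sy leqnSn.
have {dy}hS : has (fun b => ~~ S b) y.
  apply/hasP; exists d => //; move: dy; rewrite inE; case: eqP => // E.
  by rewrite E Sa in Sd.
elim: y a Sa La hS {N hN x sy} => //= b y IH a Sa La; case: (boolP (S b)) => [Sb /= hS|nSb _].
  by apply: (IH b) => //; apply: (lang_catr eL (w := [:: a])).
apply/exlP; exists a; apply/exlP; exists b; rewrite Sa nSb /=.
by apply/asboolP; apply: (lang_catl eL (v := y)).
Qed.

Lemma desubstitution L : good_lang L -> exists p s L',
  [/\ valid_S3 s, good_lang L' & L = pmL p (imL (S3_morph s) L')].
Proof.
case=> eL rL dL; have te := dL _ (lang_nil eL).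
have pl : alll (present (emat L [::])).
  by apply/alllP => a; rewrite emat_presentl //; apply/asboolP; apply: ext_letter.
have pr : alll (present (mtr (emat L [::]))).
  by apply/alllP => a; rewrite emat_presentr //; apply/asboolP; apply: (ext_letter eL).
have [p [s0 Es]] := base_class te pl pr (strongly_emat eL rL).
pose M := pmL (p^-1)%g L.
have eM : extendable M by apply: pmL_extendable.
have rM : recurrent M by apply: pmL_recurrent.
have dM : dendric_lang M by apply: pmL_dendric.
have bM : emat M [::] = base s0 by rewrite emat_pmL invgK.
have [s vs retM] := return_words eM rM dM bM.
pose L' := decL (ucode s) M; exists p, s, L'.
have EM : imL (S3_morph s) L' = M.
  apply/funext => w; apply/propext; rewrite S3_morphE.
  exact: iff_sym (imL_decL eM rM retM w).
have eL' : extendable L' by exact (decL_extendable (@ucode_l1 s) eM rM retM).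
split=> //; last by rewrite EM /M pmLK.
split=> //; first exact (decL_recurrent (@ucode_l1 s) (@ucode_inj s) eM rM).
by move=> x /(S3_image_dendric_inv vs eL')[]; rewrite ?EM.
Qed.

Lemma desubstitution_edge L v : good_lang L -> bad_type L v -> G'_vertex v ->
  exists f L' v', [/\ good_lang L', bad_type L' v', labels_edge f v v' & L = imL f L'].
Proof.
move=> gL bL Gv; have [p [s [L1 [vs [e1 r1 d1] EL]]]] := desubstitution gL.
have [v1 b1] := bad_type_exists e1 d1.
have [q Gq] := G'_vertex_orbit v1.
(* Renaming by the inverse of [q] puts the bad type of the new language among the five vertices; [q]
   itself is absorbed on the right of the morphism. *)
exists (comp3 p s q), (pmL (q^-1)%g L1), (pact (q^-1)%g v1); split.
- by split; [apply: pmL_extendable|apply: pmL_recurrent|apply: pmL_dendric].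
- exact: bad_type_pmL.
- exists p, s, q; split=> //; split=> //; rewrite pactKV.
  have bM := bad_type_pmL (p^-1)%g bL; rewrite EL pmLKV in bM.
  apply: bad_type_img bM => //.
  by case: gL => _ _ /(pmL_dendric (p := (p^-1)%g)); rewrite EL pmLKV.
by rewrite imL_comp3 pmLK.
Qed.

Lemma desubstitution_sequence L v : good_lang L -> bad_type L v -> G'_vertex v ->
  exists (sigma : nat -> morph) (Ls : nat -> language) (vv : nat -> vtx),
  [/\ Ls 0 = L, forall n, good_lang (Ls n), forall n, labels_edge (sigma n) (vv n) (vv n.+1) &
      forall n, Ls n = imL (sigma n) (Ls n.+1)].
Proof.
move=> gL bL Gv.
pose P (x : language * vtx) := [/\ good_lang x.1, bad_type x.1 x.2 & G'_vertex x.2].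
(* Dependent choice on pairs of a language and its vertex, with the invariant packed in the type. *)
have step (x : {x | P x}) : {fy : morph * {x | P x} |
    labels_edge fy.1 (sval x).2 (sval fy.2).2 /\ (sval x).1 = imL fy.1 (sval fy.2).1}.
  apply: cid; case: x => -[L0 v0] [/= g0 b0 G0].
  have [f [L' [v' [g' b' le E]]]] := desubstitution_edge g0 b0 G0.
  have P' : P (L', v') by split=> //=; case: le => p [s [q [_ []]]].
  by exists (f, exist P (L', v') P').
pose next x := (sval (step x)).2.
have P0 : P (L, v) by [].
pose xs n := iter n next (exist P (L, v) P0).
exists (fun n => (sval (step (xs n))).1), (fun n => (sval (xs n)).1), (fun n => (sval (xs n)).2).
split=> // n.
- by case: (svalP (xs n)).
- by have [] := svalP (step (xs n)).
by have [] := svalP (step (xs n)).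
Qed.

(** * Growth of the compositions *)

Section Products.
Variable sigma : nat -> morph.

Lemma tprod_cat m k u v : tprod sigma m k (u ++ v) = tprod sigma m k u ++ tprod sigma m k v.
Proof. by elim: k m => //= k IH m; rewrite IH apply_morph_cat. Qed.

Lemma tprod_nil m k : tprod sigma m k [::] = [::].
Proof. by elim: k m => //= k IH m; rewrite IH. Qed.

Lemma tprodD m k k' w : tprod sigma m (k + k') w = tprod sigma m k (tprod sigma (m + k) k' w).
Proof. by elim: k m => [|k IH] m /=; rewrite ?addn0 // IH addSnnS. Qed.

Lemma tprodSr m k w : tprod sigma m k.+1 w = tprod sigma m k (apply_morph (sigma (m + k)) w).
Proof. by rewrite -addn1 tprodD. Qed.

Lemma tprod_infix m k v w : infix v w -> infix (tprod sigma m k v) (tprod sigma m k w).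
Proof.
by case/infixP=> x [y ->]; rewrite !tprod_cat infix_catl // infix_catr // infix_refl.
Qed.

Variable Ls : nat -> language.
Hypothesis eLs : forall n, extendable (Ls n).
Hypothesis LsE : forall n, Ls n = imL (sigma n) (Ls n.+1).

Lemma Ls_tprod n k w : Ls (n + k) w -> Ls n (tprod sigma n k w).
Proof.
elim: k n => [|k IH] n; first by rewrite addn0.
rewrite -addSnnS => /IH Lw; rewrite LsE.
by exists (tprod sigma n.+1 k w); rewrite ?infix_refl.
Qed.

Hypothesis rLs : forall n, recurrent (Ls n).
Hypothesis heads : forall n, exists b, forall a, exists r, sigma n a = b :: r.

Lemma size_sigma_gt0 n a : 0 < size (sigma n a).
Proof. by have [b /(_ a)[r ->]] := heads n. Qed.

Lemma size_tprod_gt0 n k a : 0 < size (tprod sigma n k [:: a]).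
Proof.
elim: k n => //= k IH n; case: (tprod _ _ _ _) (IH n.+1) => // b w _.
by rewrite apply_morph_cons size_cat ltn_addr // size_sigma_gt0.
Qed.

(* If the minimal length stayed bounded, some letter would be the whole image of
   a letter at every later level; every other letter then adds one to the
   powers of that letter, contradicting recurrence. *)
Lemma tprod_growth n N : exists k0, forall k a, k0 <= k -> N <= size (tprod sigma n k [:: a]).
Proof.
elim: N => [|N [k0 hk0]]; first by exists 0.
case: N => [|N] in hk0 *; first by exists 0 => k a _; exact: size_tprod_gt0.
apply: contrapT => ncontra.
have small k1 : exists2 k, k1 <= k & exists a, size (tprod sigma n k [:: a]) = N.+1.
  apply: contrapT => h; apply: ncontra; exists (maxn k0 k1) => k a; rewrite geq_max => /andP[k0k
      k1k].
  rewrite ltn_neqAle hk0 // andbT; apply/eqP => E; apply: h; exists k => //.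
  by exists a.
have step k a : k0 <= k -> size (tprod sigma n k.+1 [:: a]) = N.+1 ->
    exists2 b, sigma (n + k) a = [:: b] & size (tprod sigma n k [:: b]) = N.+1.
  move=> k0k; rewrite tprodSr /apply_morph /= cats0.
  case: (sigma (n + k) a) (size_sigma_gt0 (n + k) a) => // b r _.
  rewrite -[b :: r]cat1s tprod_cat size_cat => E; exists b; last first.
    apply/eqP; rewrite eqn_leq hk0 // andbT -E leq_addr //.
  case: r E => // c r; rewrite -[c :: r]cat1s tprod_cat size_cat => E.
  have := leq_add (hk0 _ b k0k) (hk0 _ c k0k).
  have : size (tprod sigma n k [:: b]) + size (tprod sigma n k [:: c]) <= N.+1.
    by rewrite -E leq_add2l leq_addr.
  by move=> /[swap] /leq_trans h /h; rewrite addSn ltnNge leq_addl.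
have powers i : forall k a, k0 <= k -> size (tprod sigma n (k + i) [:: a]) = N.+1 ->
    exists2 b, size (tprod sigma n k [:: b]) = N.+1 & Ls (n + k) (nseq i.+1 b).
  elim: i => [|i IH] k a k0k.
    by rewrite addn0; exists a => //; apply: (ext_letter (eLs _)).
  rewrite -addSnnS => /IH[|b' sb' Lb']; first exact: leqW.
  have [b Eb sb] := step _ _ k0k sb'; exists b => //.
  have [c Lc] := lang_extr (eLs _) Lb'.
  rewrite LsE; exists (rcons (nseq i.+1 b') c); first by rewrite -addnS.
  have [b0 hb0] := heads (n + k); have [r] := hb0 b'; rewrite Eb => -[E0 _].
  have [r' Ec] := hb0 c; rewrite apply_morph_rcons Ec -E0.
  have -> : apply_morph (sigma (n + k)) (nseq i.+1 b') = nseq i.+1 b.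
    by elim: (i.+1) => //= j IHj; rewrite apply_morph_cons Eb IHj.
  apply/infixP; exists [::], r'.
  have -> : nseq i.+2 b = nseq i.+1 b ++ [:: b] by rewrite -[[:: b]]/(nseq 1 b) -nseqD addn1.
  by rewrite -catA.
(* Both [l1] and [l2] occur in every long word at level n + k0, whereas a long power of one letter
   [b] lies there. *)
have [N1 h1] := rLs (ext_letter (eLs (n + k0)) l1).
have [N2 h2] := rLs (ext_letter (eLs (n + k0)) l2).
have [k k0k [a sa]] := small (k0 + (N1 + N2)).
have [||b _ Lb] := powers (k - k0) k0 a => //.
  by rewrite subnKC // (leq_trans _ k0k) // leq_addr.
have sz : N1 + N2 <= size (nseq (k - k0).+1 b).
  by rewrite size_nseq ltnW // ltnS leq_subRL // (leq_trans _ k0k) // leq_addr.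
have := h1 _ Lb (leq_trans (leq_addr _ _) sz); rewrite infix1s mem_nseq => /eqP E1.
have := h2 _ Lb (leq_trans (leq_addl _ _) sz); rewrite infix1s mem_nseq => /eqP E2.
by rewrite -E1 in E2.
Qed.

Lemma Ls_infix_tprod n w : Ls n w ->
  exists k0, forall k a, k0 <= k -> infix w (tprod sigma n k [:: a]).
Proof.
move=> /rLs[N hN]; have [k0 hk0] := tprod_growth n N; exists k0 => k a /(hk0 k a).
by apply: hN; apply: Ls_tprod; apply: (ext_letter (eLs _)).
Qed.

Lemma Ls_primitive : primitive sigma.
Proof.
move=> n; have [k1 h1] := Ls_infix_tprod (ext_letter (eLs n) l1).
have [k2 h2] := Ls_infix_tprod (ext_letter (eLs n) l2).
have [k3 h3] := Ls_infix_tprod (ext_letter (eLs n) l3).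
exists (n + (k1 + k2 + k3).+1); split=> [|a b]; first by rewrite addnS ltnS leq_addr.
rewrite addKn -infix1s; case: (letterP a) => ->; [apply: h1|apply: h2|apply: h3];
  rewrite leqW //.
- by rewrite -addnA leq_addr.
- by rewrite addnAC leq_addl.
by rewrite leq_addl.
Qed.

Lemma Ls_tprodP n w : Ls n w <-> exists k a, infix w (tprod sigma n k [:: a]).
Proof.
split=> [/Ls_infix_tprod[k hk]|[k [a wka]]]; first by exists k, l1; apply: hk.
apply: (lang_infix (eLs n)) wka _; apply: Ls_tprod; exact: (ext_letter (eLs _)).
Qed.

End Products.

(** * Shift spaces and their languages *)

Import GRing.Theory.

Lemma size_window x i n : size (window x i n) = n.
Proof. by rewrite size_map size_iota. Qed.

Lemma window_cat x i m n :
  window x i (m + n) = window x i m ++ window x (i + m%:Z)%R n.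
Proof.
rewrite /window iotaD map_cat add0n; congr (_ ++ _).
by rewrite -[m in iota m]addn0 iotaDl -map_comp; apply: eq_map => k /=; rewrite PoszD addrA.
Qed.

Lemma window_cons x i n : window x i n.+1 = x i :: window x (i + 1)%R n.
Proof. by rewrite -add1n window_cat /window /= addr0. Qed.

Lemma window_rcons x i n : window x i n.+1 = rcons (window x i n) (x (i + n%:Z)%R).
Proof. by rewrite -addn1 window_cat -cats1 /window /= addr0. Qed.

Lemma window_translate (x : config) (d i : int) n :
  window (fun j => x (j + d)%R) i n = window x (i + d)%R n.
Proof. by apply: eq_map => k; rewrite addrAC. Qed.

Lemma window_infix x i n u w v : window x i n = u ++ w ++ v ->
  w = window x (i + (size u)%:Z)%R (size w).
Proof.
move=> E; have En : n = size u + (size w + size v).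
  by rewrite -(size_window x i n) E !size_cat.
move: E; rewrite En !window_cat => /eqP.
by rewrite eqseq_cat ?size_window // => /andP[_]; rewrite eqseq_cat ?size_window // => /andP[/eqP].
Qed.

Lemma nth_window x i n k : k < n -> nth l1 (window x i n) k = x (i + k%:Z)%R.
Proof. by move=> kn; rewrite (nth_map 0) ?size_iota // nth_iota. Qed.

(** The word is extended by one letter on each side again and again. Then [W n] covers the positions
    from -n to size w + n - 1, so position i can be read in any [W m] with m > |i|, at index i +
    m. *)
Lemma config_of_words (L : language) w :
  (forall u w v, L (u ++ w ++ v) -> L w) ->
  (forall w, L w -> exists a b, L (a :: rcons w b)) -> L w ->
  exists2 x : config, (forall i n, L (window x i n)) & w = window x 0%R (size w).
Proof.
move=> fL xL Lw.
have next (v : {v | L v}) : {v' : {v | L v} | exists a b, sval v' = a :: rcons (sval v) b}.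
  apply: cid; case: v => v Lv /=; have [a [b Lab]] := xL v Lv.
  by exists (exist L _ Lab), a, b.
pose W n := sval (iter n (fun v => sval (next v)) (exist L w Lw)).
have WS n : exists a b, W n.+1 = a :: rcons (W n) b by have := svalP (next (iter n (fun v =>
    sval (next v)) (exist L w Lw))).
have LW n : L (W n) by exact: svalP.
have sW n : size (W n) = size w + n.*2.
  elim: n => [|n IH]; first by rewrite addn0.
  by have [a [b ->]] := WS n; rewrite /= size_rcons IH doubleS !addnS.
have nW m d j : j < size (W m) -> nth l1 (W (m + d)) (j + d) = nth l1 (W m) j.
  elim: d => [|d IH] jm; first by rewrite !addn0.
  rewrite !addnS; have [a [b ->]] := WS (m + d); rewrite /= nth_rcons IH //.
  by rewrite ifT // sW doubleD addnA -sW; apply: leq_trans (_ : size (W m) + d <= _); rewrite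
      ?ltn_add2r // leq_add2l -addnn leq_addr.
pose x : config := fun i => nth l1 (W (absz i).+1) (absz (i + (absz i).+1%:Z)%R).
have xE i m : absz i < m -> x i = nth l1 (W m) (absz (i + m%:Z)%R).
  move=> im; have -> : absz (i + m%:Z)%R = absz (i + (absz i).+1%:Z)%R + (m - (absz i).+1) by lia.
  rewrite -{1}(subnKC im) nW // sW; apply: leq_trans (leq_addl _ _); lia.
have win i n m : absz i + n < m -> window x i n = take n (drop (absz (i + m%:Z)%R) (W m)).
  move=> inm; have szd : n <= size (drop (absz (i + m%:Z)%R) (W m)).
    by rewrite size_drop sW; lia.
  apply: (@eq_from_nth _ l1); first by rewrite size_window size_takel.
  move=> k; rewrite size_window => kn; rewrite nth_window // nth_take // nth_drop.
  rewrite (xE _ m); last lia.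
  congr nth; lia.
exists x => [i n|].
  rewrite (win i n (absz i + n).+1) //; set v := W _; set d := absz _.
  by apply: (fL (take d v) _ (drop n (drop d v))); rewrite !cat_take_drop; apply: LW.
apply: (@eq_from_nth _ l1); first by rewrite size_window.
move=> k kw; rewrite nth_window // (xE _ k.+1); last lia.
have -> : absz (0 + k%:Z + k.+1%:Z)%R = k + k.+1 by lia.
by rewrite -[k.+1]add0n nW.
Qed.

(** Compactness of a finite alphabet, for a decreasing sequence of nonempty sets of letters. *)
Lemma letter_pigeonhole (P : nat -> letter -> Prop) : (forall N, exists a, P N a) ->
  (forall N a, P N.+1 a -> P N a) -> exists a, forall N, P N a.
Proof.
move=> exP decP.
have mono N M a : N <= M -> P M a -> P N a.
  by move=> /subnK <-; elim: (M - N) => //= d IH /decP.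
apply: contrapT => nP.
have nPa a : exists N, ~ P N a by apply: contrapT => h; apply: nP; exists a => N; apply:
    contrapT => ?; apply: h; exists N.
have [N1 h1] := nPa l1; have [N2 h2] := nPa l2; have [N3 h3] := nPa l3.
have [a Pa] := exP (N1 + N2 + N3).
by case: (letterP a) Pa => -> Pa; [apply: h1|apply: h2|apply: h3]; apply: mono Pa; lia.
Qed.

Lemma config_of_long_words (K : language) : (forall u w v, K (u ++ w ++ v) -> K w) ->
  (forall N, exists2 w, N <= size w & K w) -> exists x : config, forall i n, K (window x i n).
Proof.
move=> fK longK.
(* A word of [K] may have no extension in [K]. [G] keeps the words with arbitrarily long contexts on
   both sides, and the pigeonhole makes it extendable. *)
pose G w := forall N, exists u v, [/\ N <= size u, N <= size v & K (u ++ w ++ v)].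
have fG u w v : G (u ++ w ++ v) -> G w.
  move=> h N; have [x [y [sx sy Kxy]]] := h N; exists (x ++ u), (v ++ y).
  rewrite !size_cat; split; [lia|lia|by move: Kxy; rewrite -!catA].
have xG w : G w -> exists a b, G (a :: rcons w b).
  move=> Gw.
  have [a Ga] : exists a, G (a :: w).
    apply: (@letter_pigeonhole (fun N a => exists u v,
      [/\ N <= size u, N <= size v & K (u ++ (a :: w) ++ v)])) => [N|N a].
      have [u [v [su sv Kuv]]] := Gw N.+1.
      case/lastP: u su Kuv => // u a; rewrite size_rcons ltnS cat_rcons => su Kuv.
      by exists a, u, v; split=> //; apply: ltnW.
    by case=> u [v [su sv Kv]]; exists u, v; split=> //; apply: ltnW.
  have [b Gb] : exists b, G (rcons (a :: w) b); last by exists a, b.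
  apply: (@letter_pigeonhole (fun N b => exists u v,
    [/\ N <= size u, N <= size v & K (u ++ rcons (a :: w) b ++ v)])) => [N|N b].
    have [u [[|b v] [su sv Kuv]]] := Ga N.+1; first by [].
    by exists b, u, v; rewrite cat_rcons; split=> //; apply: ltnW.
  by case=> u [v [su sv Kv]]; exists u, v; split=> //; apply: ltnW.
have G0 : G [::].
  move=> N; have [w sw Kw] := longK (N + N); exists (take N w), (drop N w).
  by rewrite cat_take_drop size_drop size_takel; [split=> //; lia|lia].
have [x hx _] := config_of_words fG xG G0; exists x => i n.
by have [u [v [_ _]]] := hx i n 0; apply: fK.
Qed.

Section ShiftSpace.
Variable X : config -> Prop.
Hypothesis shX : shift_space X.

Lemma translate_nat (Y : config -> Prop) (n : nat) x : shift_invariant Y ->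
  Y x <-> Y (fun i => x (i + n%:Z)%R).
Proof.
move=> iY; elim: n => [|n IH].
  by have -> : (fun i => x (i + 0%:Z)%R) = x by apply/funext => i; rewrite addr0.
rewrite IH (iY (fun i => x (i + n%:Z)%R)) /shiftmap.
have -> // : (fun i => x (i + 1 + n%:Z)%R) = (fun i => x (i + n.+1%:Z)%R).
by apply/funext => i; congr x; lia.
Qed.

Lemma translate_int (Y : config -> Prop) (d : int) x : shift_invariant Y ->
  Y x -> Y (fun i => x (i + d)%R).
Proof.
move=> iY Yx; case: d => n; first exact: (translate_nat n x iY).1 Yx.
apply/(translate_nat n.+1 _ iY).
by have -> : (fun i => x (i + n.+1%:Z + Negz n)%R) = x by apply/funext => i; congr x; lia.
Qed.

Lemma lang_window x i n : X x -> lang X (window x i n).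
Proof. by move=> Xx; exists x, i; rewrite size_window. Qed.

Lemma lang_factor u w v : lang X (u ++ w ++ v) -> lang X w.
Proof.
case=> x [i [Xx E]]; exists x, (i + (size u)%:Z)%R; split=> //.
exact: window_infix (esym E).
Qed.

Lemma lang_extendable : extendable (lang X).
Proof.
split; [exact: lang_factor| |by case: shX].
move=> w [x [i [Xx E]]]; exists (x (i - 1)%R), (x (i + (size w)%:Z)%R).
exists x, (i - 1)%R; split=> //=; rewrite size_rcons window_cons subrK window_rcons.
by rewrite -E.
Qed.

Lemma shift_space_lang x : X x <-> forall i n, lang X (window x i n).
Proof.
case: shX => cX iX _; split=> [Xx i n|h]; first exact: lang_window.
apply: cX => i n; have [y [j [Xy]]] := h i n; rewrite size_window => E.
exists (fun k => y (k + (j - i))%R); split; first exact: (translate_int (j - i)%R iX Xy).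
by rewrite window_translate E; congr window; lia.
Qed.

Lemma minimal_recurrent : minimal X -> recurrent (lang X).
Proof.
move=> mX w Lw; apply: contrapT => nrec.
(* If recurrence fails for [w], arbitrarily long words of the language avoid it; the configurations
   avoiding [w] then form a nonempty proper closed invariant subset. *)
pose K v := lang X v /\ ~~ infix w v.
have fK u v t : K (u ++ v ++ t) -> K v.
  case=> Lv nw; split; first exact: lang_factor Lv.
  by apply: contra nw => h; rewrite infix_catl // infix_catr.
have longK N : exists2 v, N <= size v & K v.
  apply: contrapT => h; apply: nrec; exists N => v Lv sv.
  by apply: contrapT => /negP nw; apply: h; exists v.
have [y hy] := config_of_long_words fK longK.
pose Y (x : config) := forall i n, K (window x i n).
have YX x : Y x -> X x by move=> Yx; apply/shift_space_lang => i n; case: (Yx i n).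
have cY : closed_set Y.
  by move=> x h i n; have [z [Yz <-]] := h i n; apply: Yz.
have iY : shift_invariant Y.
  move=> x; split=> h i n.
    by have := h (i + 1)%R n; rewrite -window_translate.
  by have := h (i - 1)%R n; rewrite /shiftmap window_translate subrK.
case: (mX Y YX cY iY) => [/(_ y)//|YE].
case: Lw => x [i [/YE Yx E]].
by have [_] := Yx i (size w); rewrite -E infix_refl.
Qed.

Lemma recurrent_minimal : recurrent (lang X) -> minimal X.
Proof.
move=> rX Y YX cY iY; case: (pselect (exists y, Y y)) => [[y Yy]|nY]; last first.
  by left=> x Yx; apply: nY; exists x.
right=> x; split=> [/YX//|Xx]; apply: cY => i n.
have [N hN] := rX _ (lang_window i n Xx).
have /infixP[u [v E]] := hN _ (lang_window 0%R N (YX _ Yy)) (eq_leq (esym (size_window _ _ _))).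
have := window_infix E; rewrite size_window => {}E.
exists (fun k => y (k + ((size u)%:Z - i))%R); split; first exact: (translate_int _ iY Yy).
by rewrite window_translate E; congr window; rewrite [LHS]addrC subrK add0r.
Qed.

End ShiftSpace.

(** * Trees *)

Section Tree.
Variables (X : config -> Prop) (w : seq letter).
Hypothesis eX : extendable (lang X).
Local Notation e := (emat (lang X) w).

Lemma ext_edgeE a b : ext_edge X w (inl a) (inr b) <-> e a b.
Proof. by split=> [h|/asboolP]; [apply/asboolP|]. Qed.

Lemma ext_edge_sym u v : ext_edge X w u v -> ext_edge X w v u.
Proof. by case: u v => a [] b. Qed.

Lemma ext_vertexl a : ext_vertex X w (inl a) <-> present e a.
Proof. by rewrite emat_presentl //; split=> [h|/asboolP]; [apply/asboolP|]. Qed.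

Lemma ext_vertexr b : ext_vertex X w (inr b) <-> present (mtr e) b.
Proof. by rewrite emat_presentr //; split=> [h|/asboolP]; [apply/asboolP|]. Qed.

Lemma shareP (f : mat) a b : reflect (exists2 d, f a d & f b d) (share f a b).
Proof.
apply: (iffP (exlP _)) => [[d]|[d fa fb]]; last by exists d; rewrite fa.
by case: ifP => // fa fb; exists d.
Qed.

Lemma tree_connected : (forall u v, ext_vertex X w u -> ext_vertex X w v ->
  exists p, ppath (ext_edge X w) u p /\ last u p = v) -> connected e.
Proof.
move=> h; apply/alllP => a; case: ifP => // pa; apply/alllP => b; case: ifP => // pb.
have [p [hp lp]] := h _ _ ((ext_vertexl a).2 pa) ((ext_vertexl b).2 pb).
(* Invariant along the path: a left vertex reached is linked to [a], and a right vertex reached is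
   adjacent to such a left vertex. *)
pose R (u : evert) : Prop := match u with inl c => linked e a c : Prop
  | inr d => exists2 c, linked e a c & e c d end.
have Ra : R (inl a).
  rewrite /R /linked; case: shareP => // -[]; case/exlP: pa => d; by exists d.
suff: R (last (inl a) p) by rewrite lp.
elim: p (inl a : evert) hp Ra {lp} => //= v p IH u [uv hp] Ru; apply: (IH v hp).
case: u v uv Ru {IH hp} => [c|d] [c'|d'] //=.
  by move=> /asboolP ecd; exists c.
move=> /asboolP ecd [c lc ec]; apply: linked_share lc _.
by apply/shareP; exists d.
Qed.

Lemma tree_treeb : extension_graph_is_tree X w -> treeb e.
Proof.
case=> [[u Vu] hconn ncyc]; rewrite treeb_acyclic; apply/and4P; split.
- by case: u Vu => [a /ext_vertexl|b /ext_vertexr]; [move/exlP=> [b]|move/exlP=> [a]] => eab;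
    apply/exlP; [exists a|exists a]; apply/exlP; exists b.
- exact: tree_connected.
- apply/alllP => a; apply/alllP => b; case: ifP => // ab; apply/alllP => a'; case: ifP => // a'b.
  apply/alllP => b'; case: ifP => // ab'; case: ifP => // a'b'.
  apply: contrapT => /negP; rewrite negb_or => /andP[naa nbb]; apply: ncyc.
  exists [:: inl a; inr b; inl a'; inr b']; split=> //.
  + by rewrite /= !inE /= !negb_or /= andbT; apply/and3P; split.
  + move=> y; rewrite !inE => /or4P[] /eqP ->;
      [apply/ext_vertexl|apply/ext_vertexr|apply/ext_vertexl|apply/ext_vertexr];
      apply/exlP; by [exists b|exists a|exists b|exists a].
  by split; [|split; [|split; [|split]]] => //; apply/ext_edgeE.
apply/alllP => a; apply/alllP => b; case: ifP => // ab; apply/alllP => a'; case: ifP => // a'b.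
apply/alllP => b'; case: ifP => // a'b'; apply/alllP => a''; case: ifP => // a''b'.
apply/alllP => b''; case: ifP => // a''b''; case: ifP => // ab''.
apply/negP => /andP[ua ub]; apply: ncyc.
exists [:: inl a; inr b; inl a'; inr b'; inl a''; inr b'']; split=> //.
+ have sub (T : eqType) (x y z : T) : uniq [:: x; y; z] -> [/\ x != y, x != z & y != z].
    by rewrite /= !inE negb_or !andbT => /andP[/andP[]].
  have [? ? ?] := sub _ _ _ _ ua; have [? ? ?] := sub _ _ _ _ ub.
  by rewrite /= !inE /= !negb_or /= !andbT; repeat (apply/andP; split).
+ move=> y; rewrite !inE => /or4P[/eqP->|/eqP->|/eqP->|/or3P[/eqP->|/eqP->|/eqP->]];
    [apply/ext_vertexl|apply/ext_vertexr|apply/ext_vertexl|apply/ext_vertexr|apply/ext_vertexl|apply/ext_vertexr];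
      apply/exlP; by [exists b|exists a|exists b'|exists a'|exists b''|exists a].
by do 6 (split; first exact/ext_edgeE).
Qed.

Definition conn (u v : evert) : Prop := exists p, ppath (ext_edge X w) u p /\ last u p = v.

Lemma conn_trans u v t : conn u v -> conn v t -> conn u t.
Proof.
case=> p [hp lp] [q [hq lq]]; exists (p ++ q); rewrite last_cat lp; split=> //.
elim: p u hp lp => [|z p IH] u /=; first by move=> _ E; rewrite E.
by case=> uz hp lp; split=> //; apply: IH.
Qed.

Lemma conn_edge u v : ext_edge X w u v -> conn u v.
Proof. by move=> uv; exists [:: v]. Qed.

Lemma conn_share a b : share e a b -> conn (inl a) (inl b).
Proof.
by case/shareP=> d /ext_edgeE ad /ext_edgeE/ext_edge_sym bd;
  apply: conn_trans (conn_edge ad) (conn_edge bd).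
Qed.

Lemma treeb_tree : treeb e -> extension_graph_is_tree X w.
Proof.
rewrite treeb_acyclic => /and4P[/exlP[a0 pa0] cn n4 n6].
have no4 a a' b b' : e a b -> e a' b -> e a b' -> e a' b' -> a != a' -> b != b' -> False.
  move=> h1 h2 h3 h4 /negPf na /negPf nb; move/alllP/(_ a)/alllP/(_ b): n4.
  by rewrite h1 => /alllP/(_ a'); rewrite h2 => /alllP/(_ b'); rewrite h3 h4 na nb.
have no6 a1 a2 a3 b1 b2 b3 : e a1 b1 -> e a2 b1 -> e a2 b2 -> e a3 b2 -> e a3 b3 -> e a1 b3 ->
    uniq [:: a1; a2; a3] -> uniq [:: b1; b2; b3] -> False.
  move=> h1 h2 h3 h4 h5 h6 ua ub; move/alllP/(_ a1)/alllP/(_ b1): n6.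
  rewrite h1 => /alllP/(_ a2); rewrite h2 => /alllP/(_ b2); rewrite h3 => /alllP/(_ a3).
  by rewrite h4 => /alllP/(_ b3); rewrite h5 h6 ua ub.
split.
- by exists (inl a0); apply/ext_vertexl.
- have connl a b : present e a -> present e b -> conn (inl a) (inl b).
    move=> pa pb; move/alllP/(_ a): cn; rewrite pa => /alllP/(_ b); rewrite pb /linked.
    case: ifP => [ab _|_ /exlP[c]]; first exact: conn_share.
    by case: ifP => // ac cb; apply: conn_trans (conn_share ac) (conn_share cb).
  have toleft u : ext_vertex X w u -> exists a, [/\ present e a, conn u (inl a) & conn (inl a) u].
    case: u => [a /ext_vertexl pa|b /ext_vertexr/exlP[a ab]].
      by exists a; split=> //; exists [::].
    have pa : present e a by apply/exlP; exists b.
    have /ext_edgeE h := ab; exists a; split=> //; apply: conn_edge => //.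
  move=> u v /toleft[a [pa ua _]] /toleft[b [pb _ vb]].
  exact: conn_trans ua (conn_trans (connl _ _ pa pb) vb).
(* A cycle has distinct vertices among six. Odd lengths contradict bipartiteness; lengths 4 and 6
   are excluded by [no4] and [no6], whichever side the cycle starts from. *)
case=> c [sc uc _]; have sc6 : size c <= 6.
  rewrite -(card_uniqP uc); apply: leq_trans (max_card _) _.
  by rewrite card_sum !card_ord.
have asb a b : ext_edge X w (inl a) (inr b) -> e a b by move/ext_edgeE.
have asb' a b : ext_edge X w (inr b) (inl a) -> e a b by move/ext_edge_sym/ext_edgeE.
have inlI a b : inl a != inl b :> evert -> a != b by apply: contra => /eqP ->.
have inrI a b : inr a != inr b :> evert -> a != b by apply: contra => /eqP ->.
have uniqE (T : eqType) (x1 x2 x3 : T) : x1 != x2 -> x1 != x3 -> x2 != x3 -> uniq [:: x1; x2; x3].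
  by move=> h1 h2 h3; rewrite /= !inE negb_or h1 h2 h3.
case: c sc uc sc6 => [|x1 [|x2 [|x3 [|x4 [|x5 [|x6 [|x7 r]]]]]]] //= _ uc _.
- by case=> h1 [h2 [h3 _]]; move: h1 h2 h3; case: (x1) => ?; case: (x2) => ?; case: (x3).
- move: uc; rewrite !inE !negb_or !andbT => /and3P[/and3P[_ n13 _] /andP[_ n24] _] [h1 [h2 [h3
    [h4 _]]]].
  case: x1 h1 h4 n13 => [a1|b1]; case: x2 h2 n24 => [a2|b2] //; case: x3 h3 => [a3|b3] //;
    case: x4 => [a4|b4] //.
    by move=> /asb h3 /asb' h2 /inrI n24 /asb h1 /asb' h4 /inlI n13; exact: (no4 a1 a3 b2 b4).
  by move=> /asb' h3 /asb h2 /inlI n24 /asb' h1 /asb h4 /inrI n13; exact: (no4 a2 a4 b1 b3).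
- case=> h1 [h2 [h3 [h4 [h5 _]]]]; move: h1 h2 h3 h4 h5.
  by case: (x1) => ?; case: (x2) => ?; case: (x3) => ?; case: (x4) => ?; case: (x5).
move: uc; rewrite !inE !negb_or !andbT.
case/and5P=> /and5P[_ n13 _ n15 _] /and4P[_ n24 _ n26] /and3P[_ n35 _] /andP[_ n46] _.
case=> h1 [h2 [h3 [h4 [h5 [h6 _]]]]].
case: x1 h1 h6 n13 n15 => [a1|b1]; case: x2 h2 n24 n26 => [a2|b2] //; case: x3 h3 n35 => [a3|b3] //;
  case: x4 h4 n46 => [a4|b4] //; case: x5 h5 => [a5|b5] //; case: x6 => [a6|b6] //.
  move=> /asb h5 /asb' h4 /inrI n46 /asb h3 /inlI n35 /asb' h2 /inrI n24 /inrI n26.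
  move=> /asb h1 /asb' h6 /inlI n13 /inlI n15.
  by apply: (no6 a1 a3 a5 b2 b4 b6) => //; apply: uniqE.
move=> /asb' h5 /asb h4 /inlI n46 /asb' h3 /inrI n35 /asb h2 /inlI n24 /inlI n26.
move=> /asb' h1 /asb h6 /inrI n13 /inrI n15.
by apply: (no6 a2 a4 a6 b3 b5 b1) => //; apply: uniqE => //; rewrite eq_sym.
Qed.

End Tree.

(** * Languages of primitive directive sequences *)

Lemma apply_morph_infix f v w : infix v w -> infix (apply_morph f v) (apply_morph f w).
Proof.
by case/infixP=> x [y ->]; rewrite !apply_morph_cat infix_catl // infix_catr // infix_refl.
Qed.

(** Blocks have length at most M: the first M letters of [v] contain the end of the block met first,
    and the next M letters contain the whole following block. *)
Lemma block_infix (B : letter -> seq letter) M z x v y : 0 < M -> (forall c, size (B c) <= M) ->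
  flatten (map B z) = x ++ v ++ y -> M + M <= size v -> exists c, infix (B c) v.
Proof.
move=> M0 hB; elim: z x => [|c z IH] x /= E sv.
  by case: x v sv E => [|? ?] [|? ?] //=; rewrite leqNgt addn_gt0 M0.
case: (leqP (size (B c)) (size x)) => sx.
  by have [x' _ /IH] := cat_prefix E sx; apply.
have [q Eq E'] := cat_prefix (esym E) (ltnW sx).
have sq : size q <= M by apply: leq_trans (hB c); rewrite Eq size_cat leq_addl.
have [v' Ev E''] := cat_prefix (esym E') (leq_trans sq (leq_trans (leq_addr _ _) sv)).
have sv' : M <= size v'.
  rewrite -(leq_add2l (size q)) -size_cat -Ev; apply: leq_trans sv.
  by rewrite leq_add2r.
case: z E'' {IH E E'} => [|d z] /= E''.
  by case: v' sv' E'' {Ev} => //=; rewrite leqNgt M0.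
have [r Er _] := cat_prefix E'' (leq_trans (hB d) sv').
by exists d; rewrite Ev Er infix_catl // infix_catr // infix_refl.
Qed.

Section Directive.
Variable sigma : nat -> morph.
Hypothesis prim : primitive sigma.
Hypothesis heads : forall n, exists b, forall a, exists r, sigma n a = b :: r.

Definition levelL (n : nat) : language :=
  fun w => exists k a, infix w (tprod sigma n k [:: a]).

Lemma primitive_large n K : exists2 k, K <= k & forall a b, a \in tprod sigma n k [:: b].
Proof.
elim: K => [|K [k Kk hk]].
  by have [N [_ hN]] := prim n; exists (N - n).
have [N [nN hN]] := prim (n + k); exists (k + (N - (n + k))); first by lia.
move=> a b; rewrite tprodD -infix1s.
have /(tprod_infix sigma n k) : infix [:: l1] (tprod sigma (n + k) (N - (n + k)) [:: b]) by
    rewrite infix1s.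
by apply: infix_trans; rewrite infix1s.
Qed.

Lemma levelL_all n w : levelL n w -> forall K, exists2 k, K <= k &
  forall b, infix w (tprod sigma n k [:: b]).
Proof.
case=> k [a wka] K; have [k' Kk' hk'] := primitive_large (n + k) K.
exists (k + k') => [|b]; first by lia.
by apply: infix_trans wka _; rewrite tprodD tprod_infix // infix1s.
Qed.

Lemma levelLE n : levelL n = imL (sigma n) (levelL n.+1).
Proof.
apply/funext => w; apply/propext; split=> [/levelL_all/(_ 1)[[//|k] _ /(_ l1) /= h]|].
  exists (tprod sigma n.+1 k [:: l1]) => //.
  by exists k, l1; rewrite infix_refl.
case=> v [k [a va]] wv; exists k.+1, a; apply: infix_trans wv _.
exact: apply_morph_infix.
Qed.

Lemma levelL_extendable n : extendable (levelL n).
Proof.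
split=> [u w v [k [a h]]|w Lw|a].
- by exists k, a; apply: infix_trans h; rewrite infix_catl // infix_catr // infix_refl.
- have [k _ hk] := levelL_all Lw 0; have [k' _ hk'] := primitive_large (n + k) 0.
  pose u := tprod sigma (n + k) k' [:: l1].
  (* Since all three letters occur in [u], it has length at least 3: [w] occurs in the block of its
     second letter, and the nonempty blocks around it supply an extension on each side. *)
  have su : size letters <= size u by apply: uniq_leq_size => // a _; apply: hk'.
  case Eu : u su => [|c1 [|c2 [|c3 r]]] // _.
  have [x [y Ey]] := infixP (hk c2).
  have Lu : tprod sigma n (k + k') [:: l1] =
     (tprod sigma n k [:: c1] ++ x) ++ w ++ (y ++ tprod sigma n k (c3 :: r)).
    rewrite tprodD -/u Eu -cat1s tprod_cat -[c2 :: _]cat1s tprod_cat Ey.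
    by rewrite -!catA.
  have s1 := size_tprod_gt0 heads n k c1.
  have s3 : 0 < size (tprod sigma n k (c3 :: r)).
    by rewrite -cat1s tprod_cat size_cat ltn_addr // size_tprod_gt0.
  move: Lu; case/lastP: (_ ++ x) (size_cat (tprod sigma n k [:: c1]) x) => [/= E|s a _]; first
      by move: s1; rewrite -(ltn_add2r (size x)) -E.
  case: (y ++ _) (size_cat y (tprod sigma n k (c3 :: r))) => [/= E|b t _ Lu]; first by move: s3;
      rewrite -(ltn_add2l (size y)) -E.
  exists a, b, (k + k'), l1; rewrite Lu cat_rcons.
  by apply/infixP; exists s, t; rewrite /= cat_rcons.
by have [k _ hk] := primitive_large n 0; exists k, l1; rewrite infix1s.
Qed.

Lemma tprod_flatten n k z : tprod sigma n k z = flatten [seq tprod sigma n k [:: c] | c <- z].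
Proof. by elim: z => [|c z IH]; rewrite ?tprod_nil // -cat1s tprod_cat IH. Qed.

Lemma levelL_recurrent n : recurrent (levelL n).
Proof.
move=> w Lw; have [k _ hk] := levelL_all Lw 0.
pose M := suml (fun c => size (tprod sigma n k [:: c])).
exists (M + M) => v Lv sv; have [k2 kk2 /(_ l1) h2] := levelL_all Lv k.
have [x [y Exy]] := infixP h2.
have M0 : 0 < M by rewrite /M /suml !addn_gt0 size_tprod_gt0.
have hM c : size (tprod sigma n k [:: c]) <= M by rewrite /M /suml; case: (letterP c) => ->; lia.
have [|c hc] := @block_infix _ M (tprod sigma (n + k) (k2 - k) [:: l1]) x v y M0 hM _ sv.
  by rewrite -tprod_flatten -tprodD subnKC.
exact: infix_trans (hk c) hc.
Qed.

(** The induction on length runs over all levels at once: a word of level n is controlled by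
    strictly shorter words of level n + 1. *)
Lemma levelL_good (v : nat -> vtx) : (forall n, labels_edge (sigma n) (v n) (v n.+1)) ->
  forall n w, levelL n w -> good (emat (levelL n) w) (v n).
Proof.
move=> edges n w; elim: {w}(size w).+1 {-2}w n (ltnSn (size w)) => // m IH w n.
rewrite ltnS => sw Lw.
have [p [s [p' [Ef [_ _ vs Ei]]]]] := edges n.
have EL : levelL n = pmL p (imL (S3_morph s) (pmL p' (levelL n.+1))).
  rewrite levelLE -imL_comp3; congr imL; exact/funext.
move: Lw; rewrite EL => Lw.
rewrite -(perm_map_inv p w) -(pactKV p (v n)) good_pmL.
apply: (S3_image_good vs _ Ei Lw) => [|x Lx].
  exact/pmL_extendable/levelL_extendable.
rewrite size_map => sx; rewrite -(perm_map_inv p' x) good_pmL.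
by apply: IH Lx; rewrite size_map (leq_trans sx).
Qed.

End Directive.

(** * The initial permutation and the equivalence *)

Lemma labels_edge_head f v v' : labels_edge f v v' -> exists b, forall a, exists r, f a = b :: r.
Proof.
case=> p [s [q [Ef _]]]; exists (p l1) => a.
by exists (map p (ucode s (q a))); rewrite Ef /comp3 S3_morphE.
Qed.

Section DirSeq.
Variables (p0 : {perm letter}) (sigma : nat -> morph).
Local Notation tau := (dir_seq p0 sigma).

Lemma tprod_dir_seqS n k w : tprod tau n.+1 k w = tprod sigma n k w.
Proof. by elim: k n => //= k IH n; rewrite IH. Qed.

Lemma tprod_dir_seq0 k w : tprod tau 0 k.+1 w = map p0 (tprod sigma 0 k w).
Proof.
rewrite /= tprod_dir_seqS; elim: (tprod _ _ _ _) => // a v IH.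
by rewrite apply_morph_cons IH.
Qed.

Lemma primitive_dir_seq : primitive tau <-> primitive sigma.
Proof.
split=> prim n.
  have [N [nN hN]] := prim n.+1; exists N.-1; split=> [|a b]; first by lia.
  by rewrite (_ : N.-1 - n = N - n.+1) -?tprod_dir_seqS //; lia.
case: n => [|n].
  have [N [nN hN]] := prim 0; exists N.+1; split=> // a b.
  have := hN ((p0^-1)%g a) b; rewrite !subn0 tprod_dir_seq0 => h.
  by apply/mapP; exists ((p0^-1)%g a); rewrite ?permKV.
have [N [nN hN]] := prim n; exists N.+1; split=> // a b.
by rewrite subSS tprod_dir_seqS.
Qed.

Lemma dir_seq_language L : extendable L ->
  (forall w, L w <-> exists k a, infix w (tprod sigma 0 k [:: a])) ->
  forall w, pmL p0 L w <-> exists k a, infix w (tprod tau 0 k [:: a]).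
Proof.
move=> eL LE w; split=> [/LE[k [a /(infix_map p0)]]|[[|k] [a]]].
- by rewrite perm_map_inv => h; exists k.+1, a; rewrite tprod_dir_seq0.
- move=> wa; apply: (lang_infix (pmL_extendable p0 eL)) wa _.
  exact: (ext_letter (pmL_extendable p0 eL)).
rewrite tprod_dir_seq0 => /(infix_map (p0^-1)%g); rewrite inv_map_perm => h.
by apply/LE; exists k, a.
Qed.

End DirSeq.

Theorem theorem5p13 (X : config -> Prop) :
  shift_space X ->
  (minimal X /\ dendric X <->
   exists (p0 : {perm letter}) (sigma : nat -> morph) (v : nat -> vtx),
     (forall n : nat, labels_edge (sigma n) (v n) (v n.+1)) /\
     primitive (dir_seq p0 sigma) /\
     (forall x : config, X x <-> generated_shift (dir_seq p0 sigma) x)).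
Proof.
move=> shX; have eX := lang_extendable shX.
split=> [[mX dX]|[p0 [sigma [v [edges [/primitive_dir_seq prim genX]]]]]].
  have dL : dendric_lang (lang X) by move=> w /dX; apply: tree_treeb.
  have gL : good_lang (lang X) by split=> //; apply: minimal_recurrent.
  (* The initial permutation serves to move the bad type of the language of X among the five
     vertices. *)
  have [v bv] := bad_type_exists eX dL; have [p Gv] := G'_vertex_orbit v.
  have g1 : good_lang (pmL (p^-1)%g (lang X)).
    by case: gL => *; split; [apply: pmL_extendable|apply: pmL_recurrent|apply: pmL_dendric].
  have [sigma [Ls [vv [L0 gLs edges LsE]]]] := desubstitution_sequence g1 (bad_type_pmL _ bv) Gv.
  have eLs n : extendable (Ls n) by case: (gLs n).
  have rLs n : recurrent (Ls n) by case: (gLs n).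
  have heads n := labels_edge_head (edges n).
  exists p, sigma, vv; split=> //; split.
    by apply/primitive_dir_seq; apply: Ls_primitive eLs LsE rLs heads.
  have LE := dir_seq_language p (eLs 0) (Ls_tprodP eLs LsE rLs heads 0).
  rewrite L0 pmLK in LE.
  by move=> x; split=> [/(shift_space_lang shX) h i n|h]; [apply/LE|apply/(shift_space_lang shX)
      => i n; apply/LE].
have heads n := labels_edge_head (edges n).
have eL n := levelL_extendable prim heads n.
have LE := dir_seq_language p0 (eL 0) (fun w => iff_refl _).
have e0 : extendable (pmL p0 (levelL sigma 0)) by apply: pmL_extendable.
have XE : lang X = pmL p0 (levelL sigma 0).
  apply/funext => w; apply/propext; split=> [[x [i [/genX gx ->]]]|Lw].
    exact/LE.
  (* A word of the generated language extends to a configuration whose factors all stay in that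
     language, hence to a point of X. *)
  have [x hx Ew] := config_of_words (@ext_fact _ e0) (@ext_both _ e0) Lw.
  exists x, 0%R; split=> //; apply/genX => i n; exact/LE.
split.
  apply: recurrent_minimal => //; rewrite XE.
  exact/pmL_recurrent/levelL_recurrent.
move=> w Lw; apply: treeb_tree => //; move: Lw; rewrite XE => Lw.
apply: pmL_dendric Lw => x Lx.
by have /and3P[] := levelL_good prim heads edges Lx.
Qed.
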